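(* Let $u$ be a weight on $\mathbb R$ and $w$ a weight on $(0,\infty)$. If $H:\Lambda^p_u(w)\to\Lambda^{p,\infty}_u(w)$ is bounded for some $0<p<\infty$, then $u\in A_\infty$.
   Context: A weight $u$ on $\mathbb R$ is locally integrable with $u>0$ a.e.; $u(E)=\int_Eu$. A weight $w$ on $(0,\infty)$ is nonnegative locally integrable, $W(t)=\int_0^tw$. $f^*_u(t)=\inf\{y>0:u(\{|f|>y\})\le t\}$; $\|f\|_{\Lambda^p_u(w)}=\left(\int_0^\infty(f^*_u)^pw\right)^{1/p}$, $\|f\|_{\Lambda^{p,\infty}_u(w)}=\sup_{t>0}f^*_u(t)W(t)^{1/p}$. $Hf(x)=\frac1\pi\lim_{\varepsilon\to0^+}\int_{|x-y|>\varepsilon}\frac{f(y)}{x-y}dy$; boundedness of $H$ means $Hf$ defined a.e. for every $f\in\Lambda^p_u(w)$ with $\|Hf\|_{\Lambda^{p,\infty}_u(w)}\le C\|f\|_{\Lambda^p_u(w)}$. $u\in A_\infty$: there exist $C>0$, $\delta\in(0,1)$ with $u(E)/u(I)\le C(|E|/|I|)^\delta$ for every interval $I$ and measurable $E\subset I$. *)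

(* Defs.v *)
From HB Require Import structures.
From mathcomp Require Import all_boot all_order all_algebra.
From mathcomp Require Import all_classical all_reals all_analysis.
Set Implicit Arguments. Unset Strict Implicit. Unset Printing Implicit Defensive.
Import Order.TTheory GRing.Theory Num.Theory.
Import numFieldNormedType.Exports.
Local Open Scope classical_set_scope.
Local Open Scope ring_scope.

Section Defs.
Variable R : realType.
Local Notation mu := (@lebesgue_measure R).

Definition weightR (u : R -> R) : Prop :=
  (forall a b : R, mu.-integrable `[a, b] (EFin \o u)) /\
  {ae mu, forall x, 0 < u x}.

(* weight on (0,oo): nonnegative, integrable on (0,t) for every t > 0
   (so that W(t) = \int_0^t w is finite) *)
Definition weight0 (w : R -> R) : Prop :=
  (forall t, 0 < t -> 0 <= w t) /\
  (forall t, 0 < t -> mu.-integrable `]0, t[ (EFin \o w)).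

Definition umeas (u : R -> R) (E : set R) : \bar R :=
  (\int[mu]_(x in E) (u x)%:E)%E.

Definition Wfun (w : R -> R) (t : R) : \bar R :=
  (\int[mu]_(s in `]0%R, t%R[) (w s)%:E)%E.

(* decreasing rearrangement f^*_u(t) = inf {y > 0 : u({|f| > y}) <= t}
   (inf of the empty set is +oo) *)
Definition rearr (u : R -> R) (f : R -> R) (t : R) : \bar R :=
  ereal_inf (EFin @` [set y : R | 0 < y /\ (umeas u [set x | (y < `|f x|)%R] <= t%:E)%E]).

Definition lorentz_norm (u w : R -> R) (p : R) (f : R -> R) : \bar R :=
  poweR (\int[mu]_(t in `]0%R, +oo[) (poweR (rearr u f t) p * (w t)%:E))%E p^-1.

Definition weak_lorentz_norm (u w : R -> R) (p : R) (f : R -> R) : \bar R :=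
  ereal_sup [set (rearr u f t * poweR (Wfun w t) p^-1)%E | t in `]0, +oo[].

Definition trunc_hilbert (f : R -> R) (x e : R) : R :=
  pi^-1 * Rintegral mu [set y | e < `|x - y|] (fun y => f y / (x - y)).

Definition hilbert_defined_at (f : R -> R) (x : R) : Prop :=
  (forall e : R, 0 < e ->
     mu.-integrable [set y | e < `|x - y|] (fun y => (f y / (x - y))%:E)) /\
  exists l : R, trunc_hilbert f x e @[e --> 0^'+] --> l.

Definition hilbert (f : R -> R) (x : R) : R :=
  lim (trunc_hilbert f x e @[e --> 0^'+]).

Definition hilbert_bounded (u w : R -> R) (p : R) : Prop :=
  exists C : R, forall f : R -> R,
    measurable_fun setT f -> (lorentz_norm u w p f < +oo)%E ->
    {ae mu, forall x, hilbert_defined_at f x} /\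
    (weak_lorentz_norm u w p (hilbert f) <= C%:E * lorentz_norm u w p f)%E.

Definition A_infty (u : R -> R) : Prop :=
  exists C delta : R, 0 < C /\ 0 < delta < 1 /\
    forall (a b : R) (I E : set R), a < b ->
      `]a, b[ `<=` I -> I `<=` `[a, b] ->
      measurable E -> E `<=` I ->
      fine (umeas u E) / fine (umeas u I) <= C * powR (fine (mu E) / (b - a)) delta.

End Defs.

(* Main.v *)
(** Testing the weak-type bound on characteristic functions gives, with
    V(t) = W(t)^(1/p), that t < u({|H 1_A| >= y}) implies y V(t) <= C V(u(A)).

    - Since H 1 is undefined, 1 is not in the Lorentz space; hence u(R) = +oo.
      Splitting an interval into three parts of equal u-mass and testing on the
      longest part gives V(3s/2) <= D V(s), and then V > 0.
    - Let E be the union of finitely many disjoint intervals ]a_i, b_i[ inside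
      the left half of I, with P = prod (x - a_i) and Q = prod (x - b_i). For
      c > 1 the roots r_i of P - c Q interlace the b_i and, when |E| / |I| is
      small, stay in I. For A = union of the ]b_i, r_i[ (the set where
      P / Q > c), H 1_A is explicit: on E, where P / Q < 0, it is at most
      - pi^-1 ln (c / (c - 1)). So c close to 1 forces
      u(E) <= u(I) / 4; the right half is symmetric.
    - Thus |E| <= alpha |I| implies u(E) <= u(I) / 2, first for finite unions of
      dyadic subintervals of I. Iterating a Calderon-Zygmund decomposition on
      the dyadic tree gives geometric decay, which passes to open sets by
      monotone limits and to measurable sets by outer regularity. *)
Require Import Defs.
From HB Require Import structures.
From mathcomp Require Import all_boot all_order all_algebra.
From mathcomp Require Import all_classical all_reals all_analysis.
From mathcomp Require Import measurable_realfun ring lra zify.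
Set Implicit Arguments. Unset Strict Implicit. Unset Printing Implicit Defensive.
Import Order.TTheory GRing.Theory Num.Theory.
Import numFieldNormedType.Exports.
Local Open Scope classical_set_scope.
Local Open Scope ring_scope.

(** * Interlacing roots and level sets *)

Section Interlacing.
Variable R : realType.
Implicit Types (a b : nat -> R) (n : nat) (c x : R).

Definition rprod a n x : R := \prod_(i < n) (x - a i).

Lemma root_between (p : {poly R}) (x y : R) : x <= y ->
  p.[x] * p.[y] <= 0 -> exists2 z, x <= z <= y & root p z.
Proof.
move=> xy; have [p0|p0] := leP p.[x] 0; have [q0|q0] := leP 0 p.[y].
- by move=> _; have [|z] := @poly_ivt R p x y xy; [rewrite p0|exists z].
- move: p0; rewrite le_eqVlt => /predU1P[px _|px]; last by nra.
  by exists x; rewrite ?lexx // /root px.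
- move: q0; rewrite le_eqVlt => /predU1P[py _|py]; last by nra.
  by exists y; rewrite ?lexx ?xy // /root -py.
- move=> _; have [|z zxy] := @poly_ivt R (- p) x y xy.
    by rewrite !hornerN !oppr_cp0 (ltW p0) ltW.
  by rewrite rootN; exists z.
Qed.

Lemma horner_rprod a n x :
  (\prod_(i < n) ('X - (a i)%:P)).[x] = rprod a n x.
Proof. by rewrite horner_prod; apply: eq_bigr => i _; rewrite hornerXsubC. Qed.

(** Write P and Q for the two products. P - c Q equals P at [b i] and - c Q at the next [a i.+1],
    and these values have opposite signs or vanish; the hypothesis at [x0] gives the last sign
    change. The n roots found this way are distinct, so they exhaust a polynomial of degree n with
    leading coefficient 1 - c. *)
Lemma interlacing_roots a b n c x0 : 1 < c ->
  (forall i, (i < n)%N -> a i < b i) ->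
  (forall i j, (i < j < n)%N -> b i <= a j) ->
  (forall i, (i < n)%N -> b i <= x0) ->
  rprod a n x0 <= c * rprod b n x0 ->
  exists r : nat -> R,
    [/\ forall i, (i < n)%N -> b i <= r i <= x0,
        forall i j, (i < j < n)%N -> r i <= a j &
        forall x, rprod a n x - c * rprod b n x = (1 - c) * rprod r n x].
Proof.
move=> c1 ab bab bx0 x0c.
pose p : {poly R} := \prod_(i < n) ('X - (a i)%:P) - c *: \prod_(i < n) ('X - (b i)%:P).
have pE x : p.[x] = rprod a n x - c * rprod b n x.
  by rewrite hornerD hornerN hornerZ !horner_rprod.
have rb i : (i < n)%N -> rprod b n (b i) = 0.
  by move=> ni; rewrite /rprod (bigD1 (Ordinal ni)) //= subrr mul0r.
have ra i : (i < n)%N -> rprod a n (a i) = 0.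
  by move=> ni; rewrite /rprod (bigD1 (Ordinal ni)) //= subrr mul0r.
have ex i : exists z, (i < n)%N ->
    [/\ b i <= z <= x0, forall j, (i < j < n)%N -> z <= a j & root p z].
  have [ni|ni] := ltnP i n; last by exists 0.
  have [ni1|ni1] := ltnP i.+1 n.
    have [||z /andP[z1 z2] rz] := @root_between p (b i) (a i.+1).
    - by apply: bab; rewrite ltnSn.
    - rewrite !pE rb // ra // mulr0 subr0 sub0r mulrN mulrCA -mulrN.
      rewrite pmulr_rle0 ?(lt_trans _ c1) // oppr_le0.
      (* In P([b i]) Q([a i.+1]) the factors are paired by index: in the pair of index j both are
         nonnegative for j <= i and both nonpositive for j > i. *)
      rewrite /rprod -big_split /= prodr_ge0 // => j _.
      have [ji|ij] := leqP j i.
        apply: mulr_ge0.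
          rewrite subr_ge0; have [<-|ij] := eqVneq (j : nat) i; first by exact: ltW (ab _ _).
          rewrite (le_trans (ltW (ab _ (ltn_ord j)))) //.
          have ji' : (j < i)%N by rewrite ltn_neqAle ij.
          by rewrite (le_trans (bab j i _)) ?ji' // ltW // ab.
        by rewrite subr_ge0 bab // ltnS ji ni1.
      apply: mulr_le0.
        by rewrite subr_le0 bab // ij ltn_ord.
      rewrite subr_le0.
      have [<-|ij'] := eqVneq i.+1 (j : nat); first by rewrite ltW // ab.
      have ij2 : (i.+1 < j)%N by rewrite ltn_neqAle ij'.
      rewrite (le_trans (ltW (ab _ ni1))) // (le_trans (bab _ j _)) ?ij2 ?ltn_ord //.
      by rewrite ltW // ab.
    exists z => _; split=> //.
      by rewrite z1 /= (le_trans z2) // (le_trans (ltW (ab _ ni1))) // bx0.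
    move=> j /andP[ij jn]; apply: (le_trans z2).
    have [<-//|ij'] := eqVneq i.+1 j.
    have ij2 : (i.+1 < j)%N by rewrite ltn_neqAle ij'.
    by rewrite (le_trans (ltW (ab _ ni1))) // bab // ij2.
  (* The last interval has no successor, so [x0] takes the place of [a i.+1]. *)
  have [||z /andP[z1 z2] rz] := @root_between p (b i) x0.
  - exact: bx0.
  - rewrite !pE rb // mulr0 subr0 mulr_ge0_le0 ?subr_le0 //.
    rewrite /rprod prodr_ge0 // => j _.
    rewrite subr_ge0; have [<-|ij] := eqVneq (j : nat) i; first by exact: ltW (ab _ _).
    have ji' : (j < i)%N.
      by rewrite ltn_neqAle ij /= -ltnS (leq_trans (ltn_ord j)).
    rewrite (le_trans (ltW (ab _ (ltn_ord j)))) //.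
    by rewrite (le_trans (bab j i _)) ?ji' // ltW // ab.
  exists z => _; split=> //; first by rewrite z1.
  by move=> j /andP[ij jn]; exfalso; lia.
have {ex} [r rP] := choice ex.
exists r; split.
- by move=> i /rP[].
- by move=> i j /andP[ij jn]; have [_ -> //] := rP i (ltn_trans ij jn); rewrite ij.
have sq (d : nat -> R) : size (\prod_(i < n) ('X - (d i)%:P)) = n.+1.
  by rewrite -big_enum size_prod_XsubC size_enum_ord.
have lq (d : nat -> R) : (\prod_(i < n) ('X - (d i)%:P))`_n = 1.
  have /monicP := monic_prod_XsubC (index_enum 'I_n) xpredT (fun i => d i).
  by rewrite /lead_coef sq.
have pn : p`_n = 1 - c by rewrite coefB coefZ !lq mulr1.
have sp : size p = n.+1.
  apply/eqP; rewrite eqn_leq; apply/andP; split.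
    rewrite (leq_trans (size_polyD _ _)) // size_polyN geq_max sq leqnn.
    by rewrite (leq_trans (size_scale_leq _ _)) // sq.
  rewrite ltnNge; apply/negP => /leq_sizeP /(_ n (leqnn n)).
  by rewrite pn => /eqP; rewrite subr_eq0 lt_eqF.
have pr : p = (1 - c) *: \prod_(z <- [seq r i | i : 'I_n <- enum 'I_n]) ('X - z%:P).
  rewrite {1}(@all_roots_prod_XsubC _ p [seq r i | i : 'I_n <- enum 'I_n]).
  - by rewrite /lead_coef sp pn.
  - by rewrite size_map size_enum_ord.
  - by apply/allP => _ /mapP[i _ ->]; have [] := rP i (ltn_ord i).
  (* Equal roots of indices i < j would give [b j <= r j = r i <= a j]. *)
  rewrite uniq_rootsE map_inj_uniq ?enum_uniq // => i j.
  wlog ij : i j / (i < j)%N.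
    move=> h rij; have [/h->//|/h h'|/val_inj//] := ltngtP i j.
    exact/esym/h'/esym.
  move=> rij; exfalso.
  have [_ /(_ j) + _] := rP i (ltn_ord i); rewrite ij ltn_ord => /(_ isT).
  have [/andP[+ _] _ _] := rP j (ltn_ord j).
  rewrite rij => /le_trans /[apply]; rewrite leNgt ab //.
move=> x; rewrite -pE pr hornerZ big_map big_enum /= horner_rprod //.
Qed.

(** The k-th pair (x - a_k)(x - b_k) is negative; every other pair is positive, since x lies outside
    the other intervals. *)
Lemma rprod_opp_sign a b n x k : (k < n)%N -> a k < x < b k ->
  (forall i j, (i < j < n)%N -> b i <= a j) ->
  (forall i, (i < n)%N -> a i < b i) ->
  rprod a n x * rprod b n x < 0.
Proof.
move=> kn /andP[akx xbk] bab ab.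
rewrite /rprod -big_split /= (bigD1 (Ordinal kn)) //= nmulr_rlt0; last first.
  by rewrite pmulr_rlt0 ?subr_gt0 ?subr_lt0.
apply: prodr_gt0 => i ik.
have ik' : (i : nat) != k by apply: contra ik => /eqP ik; apply/eqP/val_inj.
have := ab _ (ltn_ord i); have [ki|ki|] := ltngtP (i : nat) k.
- by have := bab i k; rewrite ki kn => /(_ isT); nra.
- by have := bab k i; rewrite ki ltn_ord => /(_ isT); nra.
- by move/eqP; rewrite (negbTE ik').
Qed.


(** Up to the factor [pi^-1], this is the Hilbert transform of the sum of the indicators of the []l
    i, r i[], off their endpoints. *)
Definition hlog (l r : nat -> R) n x : R :=
  \sum_(i < n) (ln `|x - l i| - ln `|x - r i|).

Lemma sum_ln_norm a n x : rprod a n x != 0 ->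
  \sum_(i < n) ln `|x - a i| = ln `|rprod a n x|.
Proof.
rewrite /rprod; elim: n => [|n IH]; first by rewrite !big_ord0 normr1 ln1.
rewrite !big_ord_recr /= mulf_eq0 negb_or => /andP[h1 h2].
by rewrite IH // normrM lnM // posrE normr_gt0.
Qed.

Lemma hlogE l r n x : rprod l n x != 0 -> rprod r n x != 0 ->
  hlog l r n x = ln `|rprod l n x| - ln `|rprod r n x|.
Proof. by move=> hl hr; rewrite /hlog sumrB !sum_ln_norm. Qed.

(** On []a k, b k[] the products P and Q have opposite signs, so |P - c Q| >= c |Q|. With S the
    product over the roots, P - c Q = (1 - c) S, hence |S| / |Q| >= c / (c - 1), and [hlog b r n] is
    ln |Q| - ln |S|. *)
Lemma level_set a b n c x0 : 1 < c ->
  (forall i, (i < n)%N -> a i < b i) ->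
  (forall i j, (i < j < n)%N -> b i <= a j) ->
  (forall i, (i < n)%N -> b i <= x0) ->
  rprod a n x0 <= c * rprod b n x0 ->
  exists r : nat -> R,
    [/\ forall i, (i < n)%N -> b i <= r i <= x0,
        forall i j, (i < j < n)%N -> r i <= b j &
        forall k x, (k < n)%N -> a k < x < b k ->
          ln (c / (c - 1)) <= `|hlog b r n x|].
Proof.
move=> c1 ab bab bx0 x0c.
have [r [r1 r2 r3]] := interlacing_roots c1 ab bab bx0 x0c.
exists r; split=> //.
  by move=> i j ij; rewrite (le_trans (r2 _ _ ij)) // ltW // ab //; case/andP: ij.
move=> k x kn kx.
have PQ := rprod_opp_sign kn kx bab ab.
have := r3 x; set P := rprod a n x in PQ *; set Q := rprod b n x in PQ *.
set S := rprod r n x => PQS.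
have Q0 : Q != 0 by apply/eqP => Q0; move: PQ; rewrite Q0 mulr0 ltxx.
have c0 : 0 < c by apply: lt_trans c1.
have c10 : 0 < c - 1 by rewrite subr_gt0.
have PQn : c * `|Q| <= `|P - c * Q|.
  have [Q1|Q1] := ltP 0 Q.
    rewrite ger0_norm ?ltW // ltr0_norm; first by nra.
    by nra.
  rewrite ler0_norm // ger0_norm; first by nra.
  by nra.
have nS : (c - 1) * `|S| = `|P - c * Q|.
  by rewrite PQS normrM distrC [in RHS](gtr0_norm c10).
have nQ0 : 0 < `|Q| by rewrite normr_gt0.
have nS0 : 0 < `|S|.
  by rewrite -(pmulr_rgt0 _ c10) nS (lt_le_trans _ PQn) // mulr_gt0.
have S0 : S != 0 by rewrite -normr_gt0.
rewrite hlogE // distrC (le_trans _ (ler_norm _)) // -ln_div ?posrE //.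
rewrite ler_ln ?posrE ?divr_gt0 // ler_pdivrMr // mulrAC ler_pdivlMr //.
by rewrite [leRHS]mulrC nS.
Qed.

(** Factor by factor, x0 - a_i = (1 + t)(x0 - b_i) with t = (b_i - a_i) / (x0 - b_i), and 1 + t <=
    e^t. This turns small total length into the condition at [x0] that keeps the roots to the left
    of [x0]. *)
Lemma rprod_le_expR a b n m x0 : m < x0 ->
  (forall i, (i < n)%N -> a i <= b i) ->
  (forall i, (i < n)%N -> b i <= m) ->
  rprod a n x0 <= expR ((\sum_(i < n) (b i - a i)) / (x0 - m)) * rprod b n x0.
Proof.
move=> mx0 ab bm.
rewrite mulr_suml expR_sum /rprod -big_split /=.
apply: ler_prod => i _.
have ab' := ab _ (ltn_ord i); have bm' := bm _ (ltn_ord i).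
have xb0 : 0 < x0 - b i by rewrite subr_gt0 (le_lt_trans bm').
apply/andP; split; first by lra.
apply: (@le_trans _ _ ((1 + (b i - a i) / (x0 - b i)) * (x0 - b i))).
  by rewrite mulrDl mulfVK ?gt_eqF // mul1r; lra.
rewrite ler_pM2r // (le_trans _ (expR_ge1Dx _)) // lerD2l.
rewrite ler_wpM2l ?subr_ge0 // lef_pV2 ?posrE ?subr_gt0 //; lra.
Qed.

Lemma level_set_right a b n c m x0 : 1 < c -> m < x0 ->
  (forall i, (i < n)%N -> a i < b i) ->
  (forall i j, (i < j < n)%N -> b i <= a j) ->
  (forall i, (i < n)%N -> b i <= m) ->
  expR ((\sum_(i < n) (b i - a i)) / (x0 - m)) <= c ->
  exists r : nat -> R,
    [/\ forall i, (i < n)%N -> b i <= r i <= x0,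
        forall i j, (i < j < n)%N -> r i <= b j &
        forall k x, (k < n)%N -> a k < x < b k ->
          ln (c / (c - 1)) <= `|hlog b r n x|].
Proof.
move=> c1 mx0 ab bab bm ec.
apply: level_set => //.
  by move=> i ni; rewrite (le_trans (bm i ni)) // ltW.
apply: (le_trans (rprod_le_expR mx0 _ bm)).
  by move=> i ni; rewrite ltW // ab.
rewrite ler_wpM2r // /rprod prodr_ge0 // => i _.
by rewrite subr_ge0 (le_trans (bm i (ltn_ord i))) // ltW.
Qed.

(** The reflection x -> - x reduces this to [level_set_right]. It reverses the order of the
    intervals, which [rv] undoes by renumbering. *)
Lemma level_set_left a b n c m x0 : 1 < c -> x0 < m ->
  (forall i, (i < n)%N -> a i < b i) ->
  (forall i j, (i < j < n)%N -> b i <= a j) ->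
  (forall i, (i < n)%N -> m <= a i) ->
  expR ((\sum_(i < n) (b i - a i)) / (m - x0)) <= c ->
  exists l : nat -> R,
    [/\ forall i, (i < n)%N -> x0 <= l i <= a i,
        forall i j, (i < j < n)%N -> a i <= l j &
        forall k x, (k < n)%N -> a k < x < b k ->
          ln (c / (c - 1)) <= `|hlog l a n x|].
Proof.
move=> c1 mx0 ab bab bm ec.
pose rv i := (n.-1 - i)%N.
have rvn i : (i < n)%N -> (rv i < n)%N by rewrite /rv; lia.
have rvK i : (i < n)%N -> rv (rv i) = i by rewrite /rv; lia.
have rvlt i j : (i < j < n)%N -> (rv j < rv i < n)%N by rewrite /rv; lia.
have sumrv (F : nat -> R) : \sum_(i < n) F (rv i) = \sum_(i < n) F i.
  rewrite [RHS](reindex_inj rev_ord_inj) /=; apply: eq_bigr => i _.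
  by congr F; rewrite /rv; have := ltn_ord i; lia.
have [|||||r [r1 r2 r3]] := @level_set_right (fun i => - b (rv i)) (fun i => - a (rv i)) n c (- m) (- x0) c1.
- by rewrite ltrN2.
- by move=> i ni; rewrite ltrN2 ab // rvn.
- by move=> i j ij; rewrite lerN2 bab // rvlt.
- by move=> i ni; rewrite lerN2 bm // rvn.
- rewrite (eq_bigr (fun i : 'I_n => b (rv i) - a (rv i))); last by move=> i _; ring.
  by rewrite (sumrv (fun i => b i - a i)) opprK addrC.
exists (fun i => - r (rv i)); split.
- move=> i ni; have := r1 _ (rvn _ ni); rewrite rvK //.
  by move=> /andP[h1 h2]; apply/andP; split; lra.
- move=> i j ij; have := r2 _ _ (rvlt _ _ ij).
  by rewrite rvK; [rewrite lerNr|case/andP: ij; apply: ltn_trans].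
move=> k x kn kx; have := r3 (rv k) (- x) (rvn _ kn).
rewrite rvK // !ltrN2 andbC => /(_ kx); congr (_ <= _).
rewrite -normrN; congr `|_|; rewrite /hlog -sumrN.
rewrite -[LHS](sumrv (fun i => - (ln `|- x - - a (rv i)| - ln `|- x - r i|))).
apply: eq_bigr => i _; rewrite rvK // opprB.
by rewrite -(normrN (- x - r _)) -(normrN (- x - - _)) !opprB !opprK ![_ + x]addrC.
Qed.

End Interlacing.

(** * The measure with density u *)

Section Umeas.
Variables (R : realType) (u : R -> R).
Local Notation mu := (@lebesgue_measure R).
Hypothesis wu : weightR u.

Lemma weightR_measurable : measurable_fun setT u.
Proof.
have -> : setT = \bigcup_n `[- n%:R, n%:R]%classic :> set R.
  apply/esym; rewrite -subTset => x _.
  exists (Num.trunc `|x|).+1 => //=; rewrite in_itv /= -ler_norml ltW //.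
  by rewrite -truncn_lt_nat.
apply/measurable_fun_bigcup => // n.
by have /measurable_int/measurable_EFinP := wu.1 (- n%:R) n%:R.
Qed.

Let mU0 (E : set R) : measurable_fun E (fun x => (u x)%:E).
Proof. by apply/measurable_EFinP/measurable_funTS; exact: weightR_measurable. Qed.

Let mu' : measurable_fun setT (fun x => `|u x|%:E).
Proof.
by apply/measurable_EFinP/measurableT_comp => //; exact: weightR_measurable.
Qed.

Let mU (E : set R) : measurable_fun E (fun x => `|u x|%:E).
Proof. exact: measurable_funTS mu'. Qed.

(** Since u is positive only almost everywhere, passing to |u| gives access to the theory of
    nonnegative integrals. *)
Lemma umeas_norm (E : set R) : measurable E ->
  umeas u E = (\int[mu]_(x in E) `|u x|%:E)%E.
Proof.
move=> mE; apply: ae_eq_integral => //.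
- exact: mU0.
- exact: mU.
have [N [mN N0 uN]] := wu.2.
exists N; split=> // x /= nx; apply: uN => /= ux; apply: nx => _.
by rewrite gtr0_norm.
Qed.

Lemma umeas_ge0 (E : set R) : measurable E -> (0 <= umeas u E)%E.
Proof. by move=> mE; rewrite umeas_norm // integral_ge0. Qed.

Lemma le_umeas (E F : set R) : measurable E -> measurable F -> E `<=` F ->
  (umeas u E <= umeas u F)%E.
Proof. 
by move=> mE mF EF; rewrite !umeas_norm // ge0_subset_integral //; exact: mU.
Qed.

Lemma umeasU (E F : set R) : measurable E -> measurable F -> [disjoint E & F] ->
  umeas u (E `|` F) = (umeas u E + umeas u F)%E.
Proof.
move=> mE mF EF; rewrite !umeas_norm ?ge0_integral_setU //.
- exact: mU.
- exact: measurableU.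
Qed.

Lemma umeas_null (E : set R) : measurable E -> mu E = 0 -> umeas u E = 0.
Proof.
by move=> mE E0; rewrite umeas_norm // null_set_integral //; exact: mU.
Qed.

Lemma umeas_fin_num (a b : R) (E : set R) : measurable E -> E `<=` `[a, b] ->
  umeas u E \is a fin_num.
Proof.
move=> mE Eab; rewrite ge0_fin_numE ?umeas_ge0 //.
apply: (le_lt_trans (le_umeas mE _ Eab)) => //.
by rewrite umeas_norm //; have /integrableP[_] := wu.1 a b.
Qed.

(** Otherwise u = 0 a.e. on the interval; together with u > 0 a.e. this covers the interval by two
    null sets. *)
Lemma umeas_gt0 (a b : R) : a < b -> (0 < umeas u `]a, b[)%E.
Proof.
move=> ab; rewrite lt0e umeas_ge0 // andbT; apply/eqP => u0.
have : (\int[mu]_(x in `]a, b[) `|(u x)%:E| = 0)%E by rewrite -umeas_norm.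
move/ae_eq_integral_abs => [] //.
  exact: mU0.
move=> N1 [mN1 N10 h1]; have [N2 [mN2 N20 h2]] := wu.2.
have : (mu `]a, b[ <= mu (N1 `|` N2))%E.
  apply: le_measure; rewrite ?inE //; first exact: measurableU.
  move=> x xab; have [ux|ux] := pselect (0 < u x).
    left; apply: h1 => /= /(_ xab) [] ux0; move: ux; by rewrite ux0 ltxx.
  by right; apply: h2.
rewrite lebesgue_measure_itv /= lte_fin ab => /le_trans.
move=> /(_ 0); rewrite measureU0 // N10 lexx => /(_ isT).
by rewrite -EFinB lee_fin subr_le0 leNgt ab.
Qed.

(** Monotone limits in the form used twice below: for u(R), and for dyadic approximations of open
    sets. *)
Lemma umeas_cvg_le (F : (set R)^nat) (E : set R) (M : \bar R) :
  nondecreasing_seq F -> (forall i, measurable (F i)) -> measurable E ->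
  E `<=` \bigcup_i F i -> (forall i, umeas u (F i) <= M)%E ->
  (umeas u E <= M)%E.
Proof.
move=> ndF mF mE EF FM.
have mB : measurable (\bigcup_i F i) by exact: bigcup_measurable.
apply: (le_trans (le_umeas mE mB EF)).
rewrite umeas_norm //.
have h : (\int[mu]_(x in F i) `|u x|%:E)%E @[i --> \oo] -->
    (\int[mu]_(x in \bigcup_i F i) `|u x|%:E)%E.
  by apply: ge0_nondecreasing_set_cvg_integral => // i; exact: mU.
rewrite -(cvg_lim _ h) //; apply: lime_le; first by apply/cvg_ex; eexists; exact: h.
by near=> i; rewrite -umeas_norm.
Unshelve. all: by end_near. Qed.

End Umeas.

(** * Hilbert transform of a finite union of intervals *)

Section Hilbert.
Variable R : realType.
Local Notation mu := (@lebesgue_measure R).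
Implicit Types (l r x e : R).

Lemma is_derive_ln_scaled (s x y : R) : 0 < s * (x - y) ->
  is_derive y 1 (fun z : R => - ln (s * (x - z))) (x - y)^-1.
Proof.
move=> sxy.
have s0 : s != 0 by apply/eqP => s0; move: sxy; rewrite s0 mul0r ltxx.
have h1 : is_derive y 1 (fun z : R => s * (x - z)) (- s).
  have -> : - s = s *: (0 - 1) by rewrite /GRing.scale /= sub0r mulrN1.
  exact: is_deriveZ.
have := @is_derive1_comp _ (@ln R) (fun z : R => s * (x - z)) y _ _ (is_derive1_ln sxy) h1.
move=> /is_deriveN; rewrite /comp; set D := (X in is_derive _ _ _ X -> _).
suff -> : D = (x - y)^-1 by [].
rewrite /D invfM mulrN opprK mulrAC mulVf ?mul1r //.
Qed.

(** The antiderivative is - ln (s (x - y)). The sign of [s] keeps the argument of the logarithm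
    positive, so one computation serves both sides of x. *)
Lemma integral_cauchy_kernel (s l r x : R) : l < r ->
  (forall y, l <= y <= r -> 0 < s * (x - y)) ->
  mu.-integrable `[l, r] (fun y => ((x - y)^-1)%:E) /\
  \int[mu]_(y in `[l, r]) (x - y)^-1 = ln `|x - l| - ln `|x - r|.
Proof.
move=> lr sxy.
have s0 : s != 0.
  by apply/eqP => s0; have := sxy l; rewrite lexx ltW // s0 mul0r ltxx => /(_ isT).
have xy0 y : l <= y <= r -> x - y != 0.
  by move=> /sxy; apply: contraTneq => ->; rewrite mulr0 ltxx.
have ctsf : {within `[l, r], continuous (fun y => (x - y)^-1)}.
  apply: continuous_in_subspaceT => y /set_mem /= yI.
  apply: cvgV; first by apply: xy0; rewrite in_itv in yI.
  by apply: cvgB; [exact: cvg_cst|exact: cvg_id].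
have drv y : l <= y <= r -> is_derive y 1 (fun z : R => - ln (s * (x - z))) (x - y)^-1.
  by move=> /sxy; exact: is_derive_ln_scaled.
have ctsF y : l <= y <= r -> {for y, continuous (fun z : R => - ln (s * (x - z)))}.
  by move=> /drv dy; apply/differentiable_continuous/derivable1_diffP; exact: ex_derive.
split.
  exact: (@continuous_compact_integrable R (fun y : R => (x - y)^-1) _ (@segment_compact R l r) ctsf).
rewrite /Rintegral (@continuous_FTC2 R _ (fun z : R => - ln (s * (x - z))) l r lr ctsf).
- have lnE y : l <= y <= r -> ln (s * (x - y)) = ln `|s| + ln `|x - y|.
    move=> yI; rewrite -lnM ?posrE ?normr_gt0 ?xy0 // -normrM gtr0_norm //.
    exact: sxy.
  rewrite /= !lnE ?lexx ?ltW //; ring.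
- split.
  + by move=> y; rewrite in_itv /= => /andP[ly yr]; have [] := drv y; rewrite ?ltW.
  + by apply: cvg_at_right_filter; apply: ctsF; rewrite lexx ltW.
  + by apply: cvg_at_left_filter; apply: ctsF; rewrite lexx ltW.
- move=> y; rewrite in_itv /= => /andP[ly yr]; rewrite derive1E.
  by have [] := drv y; rewrite ?ltW.
Qed.

Lemma integral_cauchy_kernel_oo l r x : l <= r -> x < l \/ r < x ->
  mu.-integrable `]l, r[ (fun y => ((x - y)^-1)%:E) /\
  \int[mu]_(y in `]l, r[) (x - y)^-1 = ln `|x - l| - ln `|x - r|.
Proof.
rewrite le_eqVlt => /predU1P[->|lr] xlr.
  by rewrite set_itvoo0 Rintegral_set0 subrr; split=> //; exact: integrable_set0.
have [s sP] : exists s : R, forall y, l <= y <= r -> 0 < s * (x - y).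
  case: xlr => h; [exists (-1)|exists 1] => y /andP[ly yr]; lra.
have [h1 h2] := integral_cauchy_kernel lr sP.
have h3 : mu.-integrable `]l, r[ (fun y => ((x - y)^-1)%:E).
  by apply: integrableS h1 => //; exact: subset_itv_oo_cc.
split=> //; rewrite -h2 /Rintegral (@integral_itv_bndoo R l r _ true false) //.
exact: (measurable_int mu h3).
Qed.

Lemma measurable_trunc_domain x e : measurable [set y : R | e < `|x - y|].
Proof.
apply: open_measurable.
rewrite (_ : [set _ | _] = (fun y => `|x - y|) @^-1` `]e, +oo[); last first.
  by apply/seteqP; split => y /=; rewrite in_itv /= andbT.
apply: open_comp; last exact: interval_open.
move=> y _; apply: cvg_norm; apply: cvgB; [exact: cvg_cst|exact: cvg_id].
Qed.

(** Once e is below the distance from x to the endpoints, the truncated integral no longer depends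
    on e: either the truncation misses the interval, or x is inside and the two ln e terms
    cancel. *)
Lemma near_trunc_indic_itv l r x : l <= r -> x != l -> x != r ->
  \forall e \near 0^'+,
    mu.-integrable [set y | e < `|x - y|] (fun y => (\1_(`]l, r[%classic) y / (x - y))%:E) /\
    \int[mu]_(y in [set y | e < `|x - y|]) (\1_(`]l, r[%classic) y / (x - y)) =
      ln `|x - l| - ln `|x - r|.
Proof.
move=> lr xl xr.
have red e (v : R) :
   mu.-integrable ([set y | e < `|x - y|] `&` `]l, r[) (fun y => ((x - y)^-1)%:E) /\
   \int[mu]_(y in [set y | e < `|x - y|] `&` `]l, r[) (x - y)^-1 = v ->
   mu.-integrable [set y | e < `|x - y|] (fun y => (\1_(`]l, r[%classic) y / (x - y))%:E) /\
   \int[mu]_(y in [set y | e < `|x - y|]) (\1_(`]l, r[%classic) y / (x - y)) = v.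
  have E y : ((fun y => (x - y)^-1) \_ (`]l, r[%classic)) y = \1_(`]l, r[%classic) y / (x - y).
    by rewrite patchE indicE; case: (y \in _); rewrite ?mul1r ?mul0r.
  move=> [h1 <-]; split.
    apply: (@eq_integrable _ _ _ mu _ (measurable_trunc_domain x e)
      ((fun y => ((x - y)^-1)%:E) \_ (`]l, r[%classic))).
      by move=> y _; rewrite -E !patchE; case: ifP.
    by apply/integrable_restrict => //; exact: measurable_trunc_domain.
  rewrite Rintegral_mkcondr; apply: eq_Rintegral => y _; exact/esym/E.
have [[xl'|rx]|] : (x < l \/ r < x) \/ l < x < r.
  move: xl xr; rewrite !neq_lt => /orP[h _|h1 /orP[h2|h2]]; [by left; left| |by left; right].
  by right; rewrite h1.
- near=> e; apply: red.
  have -> : [set y | e < `|x - y|] `&` `]l, r[ = `]l, r[%classic.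
    apply/setIidPr => y /=; rewrite in_itv /= => /andP[ly _].
    rewrite distrC (lt_le_trans _ (ler_norm _)) // ltrBrDr.
    apply: (lt_trans _ ly); rewrite -ltrBrDr.
    by near: e; apply: nbhs_right_lt; rewrite subr_gt0.
  by apply: integral_cauchy_kernel_oo => //; left.
- near=> e; apply: red.
  have -> : [set y | e < `|x - y|] `&` `]l, r[ = `]l, r[%classic.
    apply/setIidPr => y /=; rewrite in_itv /= => /andP[_ yr].
    rewrite (lt_le_trans _ (ler_norm _)) // ltrBrDr -ltrBrDl.
    apply: (lt_trans yr); rewrite ltrBrDr -ltrBrDl.
    by near: e; apply: nbhs_right_lt; rewrite subr_gt0.
  by apply: integral_cauchy_kernel_oo => //; right.
(* Here x is inside: the truncation leaves []l, x - e[] and []x + e, r[], contributing - ln e and +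
   ln e. *)
move=> /andP[lx xr']; near=> e; apply: red.
have e0 : 0 < e by near: e; exact: nbhs_right_gt.
have el : e < x - l by near: e; apply: nbhs_right_lt; rewrite subr_gt0.
have er : e < r - x by near: e; apply: nbhs_right_lt; rewrite subr_gt0.
have -> : [set y | e < `|x - y|] `&` `]l, r[ = `]l, x - e[ `|` `]x + e, r[.
  apply/seteqP; split => y /=; rewrite !in_itv /=.
    move=> [exy /andP[ly yr]]; move: exy; rewrite ltr_normr => /orP[h|h].
      by left; rewrite ly /=; lra.
    by right; rewrite yr andbT; lra.
  case=> /andP[h1 h2].
    by rewrite ltr_normr h1 /=; split; [apply/orP; left; lra | lra].
  by rewrite ltr_normr h2 andbT; split; [apply/orP; right; lra | lra].
have [||i1 v1] := @integral_cauchy_kernel_oo l (x - e) x; [lra|right; lra|].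
have [||i2 v2] := @integral_cauchy_kernel_oo (x + e) r x; [lra|left; lra|].
have dj : [disjoint `]l, (x - e)[%classic & `](x + e), r[%classic].
  apply/disj_setPS => y /= [] /=; rewrite !in_itv /= => /andP[_ h1] /andP[h2 _].
  lra.
have iU : mu.-integrable (`]l, x - e[ `|` `]x + e, r[) (fun y => ((x - y)^-1)%:E).
  apply/integrableP; split.
    apply/measurable_funU => //; split; [exact: (measurable_int mu i1)|exact: (measurable_int mu i2)].
  rewrite ge0_integral_setU //; first by apply: lte_add_pinfty; [have /integrableP[] := i1|have /integrableP[] := i2].
  apply: measurableT_comp => //.
  apply/measurable_funU => //; split; [exact: (measurable_int mu i1)|exact: (measurable_int mu i2)].
split=> //.
rewrite Rintegral_setU // v1 v2.
have -> : x - (x - e) = e by ring.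
have -> : x - (x + e) = - e by ring.
rewrite normrN; ring.
Unshelve. all: by end_near. Qed.

(** The truncations are eventually constant as e tends to 0, so the principal value is that
    constant. *)
Lemma hilbert_sum_itv (l r : nat -> R) n x :
  (forall i, (i < n)%N -> [/\ l i <= r i, x != l i & x != r i]) ->
  hilbert (fun y => \sum_(i < n) \1_(`]l i, r i[%classic) y) x = pi^-1 * hlog l r n x.
Proof.
move=> lr.
have h : \forall e \near 0^'+,
    mu.-integrable [set y | e < `|x - y|]
      (fun y => ((\sum_(i < n) \1_(`]l i, r i[%classic) y) / (x - y))%:E) /\
    \int[mu]_(y in [set y | e < `|x - y|])
      ((\sum_(i < n) \1_(`]l i, r i[%classic) y) / (x - y)) = hlog l r n x.
  rewrite /hlog; elim: n lr => [|n IH] lr.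
    near=> e; have md := measurable_trunc_domain x e; split.
      apply: (@eq_integrable _ _ _ mu _ md (cst 0)); last exact: integrable0.
      by move=> y _; rewrite big_ord0 mul0r.
    under eq_Rintegral do rewrite big_ord0 mul0r.
    by rewrite Rintegral_cst ?mul0r ?big_ord0 //; exact: measurable_trunc_domain.
  have [lr1 lr2 lr3] := lr n (ltnSn n).
  have IHn := IH (fun i ni => lr i (ltnW ni)).
  have hn := near_trunc_indic_itv lr1 lr2 lr3.
  near=> e.
  have [i1 v1] : mu.-integrable [set y | e < `|x - y|]
      (fun y => ((\sum_(i < n) \1_(`]l i, r i[%classic) y) / (x - y))%:E) /\
    \int[mu]_(y in [set y | e < `|x - y|])
      ((\sum_(i < n) \1_(`]l i, r i[%classic) y) / (x - y)) =
    \sum_(i < n) (ln `|x - l i| - ln `|x - r i|) by near: e.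
  have [i2 v2] : mu.-integrable [set y | e < `|x - y|]
      (fun y => (\1_(`]l n, r n[%classic) y / (x - y))%:E) /\
    \int[mu]_(y in [set y | e < `|x - y|]) (\1_(`]l n, r n[%classic) y / (x - y)) =
    ln `|x - l n| - ln `|x - r n| by near: e.
  have md := measurable_trunc_domain x e.
  split.
    have i12 := @integrableD _ _ _ mu _ md _ _ i1 i2.
    apply: (@eq_integrable _ _ _ mu _ md _ _ _ i12); move=> y _.
    by rewrite /= big_ord_recr /= mulrDl EFinD.
  under eq_Rintegral do rewrite big_ord_recr /= mulrDl.
  by rewrite RintegralD // v1 v2 big_ord_recr.
rewrite /hilbert; apply/cvg_lim => //; apply: cvg_near_cst.
near=> e; rewrite /trunc_hilbert; congr (_ * _).
have [] : mu.-integrable [set y | e < `|x - y|]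
      (fun y => ((\sum_(i < n) \1_(`]l i, r i[%classic) y) / (x - y))%:E) /\
    \int[mu]_(y in [set y | e < `|x - y|])
      ((\sum_(i < n) \1_(`]l i, r i[%classic) y) / (x - y)) = hlog l r n x by near: e.
by [].
Unshelve. all: by end_near. Qed.

End Hilbert.

(** * Restricted weak-type estimate *)

Section Lorentz.
Variables (R : realType) (u w : R -> R) (p : R).
Local Notation mu := (@lebesgue_measure R).
Hypotheses (wu : weightR u) (ww : weight0 w) (p0 : 0 < p).

Lemma umeas_set0 : umeas u set0 = 0.
Proof. exact: integral_set0. Qed.

(** The set where the indicator exceeds y is E for 0 < y < 1 and empty for y >= 1. So every y >= 1
    is admissible in the infimum, and the smaller ones exactly when u(E) <= t. *)
Lemma rearr_indic (E : set R) (t : R) : 0 < t ->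
  rearr u \1_E t = if (t%:E < umeas u E)%E then 1%E else 0%E.
Proof.
move=> t0; rewrite /rearr.
have lt1 (y : R) : 0 < y -> y < 1 -> [set x | y < `|\1_E x|] = E.
  move=> y0 y1; apply/seteqP; split => x /=; rewrite indicE.
    by case: (boolP (x \in E)) => [/set_mem//|_]; rewrite normr0 ltNge ltW.
  by move=> xE; rewrite mem_set // normr1.
have ge1 (y : R) : 1 <= y -> [set x | y < `|\1_E x|] = set0.
  move=> y1; apply/seteqP; split => x //=; rewrite indicE ltNge.
  by case: (x \in E); rewrite ?normr1 ?y1 // normr0 (le_trans _ y1).
case: ifPn => [tE|]; last rewrite -leNgt => Et.
  apply/eqP; rewrite eq_le; apply/andP; split.
    apply: ereal_inf_lbound; exists 1 => //=; split=> //.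
    by rewrite ge1 // umeas_set0 lee_fin ltW.
  apply: le_ereal_inf_tmp => _ [y [y0 uy] <-]; rewrite lee_fin.
  by have [//|y1] := leP 1 y; move: uy; rewrite lt1 // leNgt tE.
apply/eqP; rewrite eq_le; apply/andP; split; last first.
  by apply: le_ereal_inf_tmp => _ [y [y0 _] <-]; rewrite lee_fin ltW.
apply/lee_addgt0Pr => e e0; rewrite add0e.
apply: ereal_inf_lbound; exists e => //; split=> //.
have [e1|e1] := ltP e 1; first by rewrite lt1.
by rewrite ge1 // umeas_set0 lee_fin ltW.
Qed.

Lemma Wfun_ge0 t : (0 <= Wfun w t)%E.
Proof.
by apply: integral_ge0 => s /=; rewrite in_itv /= lee_fin => /andP[/ww.1].
Qed.

Lemma Wfun_fin_num t : Wfun w t \is a fin_num.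
Proof.
have [t0|t0] := ltP 0 t; last by rewrite /Wfun set_itv_ge ?integral_set0 // bnd_simp -leNgt.
apply: integrable_fin_num => //; exact: ww.2.
Qed.

Lemma le_Wfun s t : s <= t -> (Wfun w s <= Wfun w t)%E.
Proof.
move=> st; have [t0|t0] := ltP 0 t; last first.
  by rewrite {1}/Wfun set_itv_ge ?integral_set0 ?Wfun_ge0 // bnd_simp -leNgt (le_trans st).
apply: ge0_subset_integral => //.
- exact: (measurable_int mu (ww.2 _ t0)).
- by move=> x /=; rewrite in_itv /= lee_fin => /andP[/ww.1].
- by move=> x /=; rewrite !in_itv /= => /andP[-> /lt_le_trans]; exact.
Qed.

(** The fundamental function of the Lorentz space: the norm of the indicator of a set of u-mass
    t. *)
Definition Vfun t : R := fine (Wfun w t) `^ p^-1.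

Lemma poweR_Wfun t : poweR (Wfun w t) p^-1 = (Vfun t)%:E.
Proof. by rewrite -(fineK (Wfun_fin_num t)) poweR_EFin. Qed.

Lemma Vfun_ge0 t : 0 <= Vfun t.
Proof. exact: powR_ge0. Qed.

Lemma le_Vfun s t : s <= t -> Vfun s <= Vfun t.
Proof.
move=> st; apply: ge0_ler_powR; rewrite ?nnegrE ?fine_ge0 ?Wfun_ge0 //.
  by rewrite invr_ge0 ltW.
by apply: fine_le; rewrite ?Wfun_fin_num ?le_Wfun.
Qed.

Lemma lorentz_norm_indic (E : set R) (T : R) : umeas u E = T%:E ->
  lorentz_norm u w p \1_E = (Vfun T)%:E.
Proof.
move=> ET; rewrite -poweR_Wfun /lorentz_norm; congr poweR.
pose wT : R -> \bar R := (EFin \o w) \_ (`]0, T[%classic).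
transitivity (\int[mu]_(t in `]0%R, +oo[) wT t)%E.
  apply: eq_integral => t /set_mem /=; rewrite in_itv /= andbT => t0.
  rewrite rearr_indic // ET lte_fin /wT patchE.
  have -> : (t \in `]0, T[%classic) = (t < T).
    by apply/idP/idP => [/set_mem/=|tT]; [rewrite in_itv /= => /andP[]|rewrite inE /= in_itv /= t0].
  case: ifP => _; first by rewrite poweR1r mul1e.
  by rewrite poweR0r ?gt_eqF // mul0e.
rewrite -integral_mkcondr; congr (integral _ _ _).
by apply/setIidPr => t /=; rewrite !in_itv /= => /andP[->].
Qed.

(** For z < y the set where |g| > z contains S and has mass above t, so z is not admissible in the
    infimum. *)
Lemma le_rearr (g : R -> R) (S : set R) (y t : R) :
  (forall z, measurable [set x | z < `|g x|]) -> measurable S ->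
  (forall x, S x -> y <= `|g x|) -> (t%:E < umeas u S)%E ->
  (y%:E <= rearr u g t)%E.
Proof.
move=> mg mS Sg tS; apply: le_ereal_inf_tmp => _ [z [z0 zt] <-].
rewrite lee_fin leNgt; apply/negP => zy.
have := lt_le_trans tS (le_umeas wu mS (mg z) _).
rewrite ltNge zt => /(_ _)/negP; apply => // x /Sg; exact: lt_le_trans.
Qed.

Lemma measurable_hlog (l r : nat -> R) n : measurable_fun setT (hlog l r n).
Proof.
apply: measurable_sum => i; apply: measurable_funB.
  by apply: measurableT_comp => //; apply: measurableT_comp => //; apply: measurable_funB.
by apply: measurableT_comp => //; apply: measurableT_comp => //; apply: measurable_funB.
Qed.

Lemma finite_measurable (F : set R) : finite_set F -> measurable F.
Proof. by move=> /finite_set_countable; exact: countable_measurable (@measurable_set1 R). Qed.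

Lemma finite_lebesgue_measure0 (F : set R) : finite_set F -> mu F = 0.
Proof. by move=> /finite_set_countable; exact: countable_lebesgue_measure0. Qed.

Lemma sum_indic_itv (l r : nat -> R) n :
  (forall i j, (i < j < n)%N -> r i <= l j) ->
  (fun y => \sum_(i < n) \1_(`]l i, r i[%classic) y) =
    \1_(\bigcup_(i < n) `]l i, r i[%classic) :> (R -> R).
Proof.
move=> rl; apply/funext => y; rewrite indicE.
case: (boolP (y \in _)) => [/set_mem [k /= kn yk]|ny].
  rewrite (bigD1 (Ordinal kn)) //= indicE mem_set // big1 ?addr0 // => i ik.
  rewrite indicE memNset //= in_itv /= => /andP[h1 h2].
  move: yk; rewrite /= in_itv /= => /andP[h3 h4].
  have ik' : (i : nat) != k by apply: contra ik => /eqP ik; apply/eqP/val_inj.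
  have [ki|ki|] := ltngtP (i : nat) k.
  - by have := rl i k; rewrite ki kn => /(_ isT); lra.
  - by have := rl k i; rewrite ki ltn_ord => /(_ isT); lra.
  - by move/eqP; rewrite (negbTE ik').
rewrite big1 // => i _; rewrite indicE memNset // => yi.
by move/negP: ny; apply; apply/mem_set; exists i => /=.
Qed.

(** The weak-type bound is applied to the indicator of the union A of the []l i, r i[], whose
    Hilbert transform is [pi^-1 * hlog l r n] off the endpoints; then V(u(A)) is bounded by
    monotonicity. *)
Lemma restricted_weak_type : hilbert_bounded u w p ->
  exists2 K : R, 0 < K & forall (l r : nat -> R) n (a b : R) (S : set R) (y t : R),
    (forall i, (i < n)%N -> [/\ a <= l i, l i <= r i & r i <= b]) ->
    (forall i j, (i < j < n)%N -> r i <= l j) ->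
    measurable S -> (forall x, S x -> y <= `|hlog l r n x|) ->
    0 < t -> (t%:E < umeas u S)%E ->
    y * Vfun t <= K * Vfun (fine (umeas u `]a, b[)).
Proof.
(* The factor pi absorbs the normalisation of H; |C| + 1 makes the constant positive. *)
move=> [C hC]; exists (pi * (`|C| + 1)).
  by rewrite mulr_gt0 ?pi_gt0 // ltr_wpDl.
move=> l r n a b S y t lr rl mS Sy t0 tS.
pose f : R -> R := fun y => \sum_(i < n) \1_(`]l i, r i[%classic) y.
pose A := \bigcup_(i < n) `]l i, r i[%classic.
have fA : f = \1_A by exact: sum_indic_itv.
have mA : measurable A by apply: bigcup_measurable.
have Aab : A `<=` `]a, b[.
  move=> x [i /= /lr[h1 _ h2]]; rewrite /= !in_itv /= => /andP[h3 h4].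
  by rewrite (le_lt_trans h1) //= (lt_le_trans h4).
have finab : umeas u `]a, b[ \is a fin_num.
  by apply: (umeas_fin_num wu) => //; exact: subset_itv_oo_cc.
have finA : umeas u A \is a fin_num.
  apply: (umeas_fin_num wu (a := a) (b := b)) => //.
  by apply: (subset_trans Aab); exact: subset_itv_oo_cc.
have nA : lorentz_norm u w p f = (Vfun (fine (umeas u A)))%:E.
  by rewrite fA; apply: lorentz_norm_indic; rewrite fineK.
have [||_ hf] := hC f.
- by rewrite fA; exact: measurable_indic.
- by rewrite nA ltry.
pose F : set R := \bigcup_(i < n) [set l i; r i].
have finF : finite_set F by apply: bigcup_finite => // i _; exact: finite_set2.
have HF x : ~ F x -> hilbert f x = pi^-1 * hlog l r n x.
  move=> Fx; apply: hilbert_sum_itv => i ni; have [_ lri _] := lr i ni.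
  by split=> //; apply/eqP => xE; apply: Fx; exists i => //=; [left|right].
have mF : measurable F by exact: finite_measurable.
have mH z : measurable [set x | z < `|hilbert f x|].
  rewrite (_ : [set _ | _] = ([set x | z < `|pi^-1 * hlog l r n x|] `\` F) `|`
     (F `&` [set x | z < `|hilbert f x|])); last first.
    apply/seteqP; split => x /=.
      move=> zx; have [Fx|Fx] := pselect (F x); first by right.
      by left; split=> //; rewrite -HF.
    by move=> [[zx Fx]|[]//]; rewrite HF.
  apply: measurableU; last by apply: finite_measurable; exact: finite_setIl.
  apply: measurableD => //.
  have mh : measurable_fun setT (fun x => `|pi^-1 * hlog l r n x|).
    by apply: measurableT_comp => //; apply: measurable_funM => //; exact: measurable_hlog.
  have := mh measurableT `]z, +oo[%classic (measurable_itv _).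
  rewrite setTI; congr measurable; apply/seteqP; split => x /=; by rewrite in_itv /= andbT.
have tSF : (t%:E < umeas u (S `\` F))%E.
  rewrite (lt_le_trans tS) // -[in leLHS](setDUK (@subIsetl _ S F)) setIC umeasU //.
  - rewrite umeas_null ?add0e //.
    + by rewrite setIC setDIr setDv set0U.
    + exact: measurableI.
    + by apply: finite_lebesgue_measure0; exact: finite_setIl.
  - exact: measurableI.
  - by apply: measurableD => //; exact: measurableI.
  - by apply/disj_setPS => x [] /= ? [].
have yr : ((pi^-1 * y)%:E <= rearr u (hilbert f) t)%E.
  apply: (le_rearr mH _ _ tSF); first exact: measurableD.
  move=> x [Sx Fx]; rewrite HF // normrM gtr0_norm ?invr_gt0 ?pi_gt0 //.
  by rewrite ler_pM2l ?invr_gt0 ?pi_gt0 //; exact: Sy.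
have : (rearr u (hilbert f) t * poweR (Wfun w t) p^-1 <= C%:E * lorentz_norm u w p f)%E.
  by apply: le_trans hf; apply: ereal_sup_ubound; exists t => //=; rewrite in_itv /= t0.
rewrite nA poweR_Wfun => h.
have : ((pi^-1 * y * Vfun t)%:E <= (C * Vfun (fine (umeas u A)))%:E)%E.
  by apply: le_trans h; rewrite EFinM lee_wpmul2r // lee_fin Vfun_ge0.
rewrite lee_fin => h'.
have scale (q v c : R) : 0 < q -> q^-1 * y * v <= c -> y * v <= q * c.
  by move=> q0; rewrite -mulrA ler_pdivrMl.
apply: (le_trans (scale _ _ _ (pi_gt0 R) h')); rewrite -mulrA.
apply: ler_wpM2l; first exact: pi_ge0.
apply: (@le_trans _ _ (`|C| * Vfun (fine (umeas u A)))).
  by apply: ler_wpM2r; rewrite ?Vfun_ge0 // ler_norm.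
apply: ler_pM; [exact: normr_ge0|exact: Vfun_ge0|by rewrite lerDl|].
by apply: le_Vfun; apply: fine_le => //; exact: le_umeas.
Qed.

End Lorentz.

(** * Doubling *)

Section Doubling.
Variables (R : realType) (u w : R -> R) (p : R).
Local Notation mu := (@lebesgue_measure R).
Hypotheses (wu : weightR u) (ww : weight0 w) (p0 : 0 < p).
Hypothesis hb : hilbert_bounded u w p.
Local Notation V := (Vfun w p).

(** Otherwise H 1 would be defined at some x, making 1 / (x - y) integrable over |x - y| > 1,
    whereas that integral diverges logarithmically. *)
Lemma lorentz_norm_indicT : ~ (lorentz_norm u w p \1_[set: R] < +oo)%E.
Proof.
have [C hC] := hb => norm1.
have [//|[N [mN N0 Nsub]] _] := hC \1_[set: R] _ norm1.
have [x Nx] : exists x : R, ~ N x.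
  apply/existsNP => NT.
  have : (mu `[0%R, 1%R] <= mu N)%E by apply: le_measure; rewrite ?inE.
  by rewrite N0 lebesgue_measure_itv /= lte_fin ltr01 oppr0 adde0 lee_fin ler10.
have [hx _] : hilbert_defined_at (\1_[set: R]) x.
  by apply: contrapT => h; apply: Nx; exact: Nsub.
have {hx} hx := hx 1 ltr01.
pose D : set R := [set y | 1 < `|x - y|].
have mD : measurable D := measurable_trunc_domain x 1.
have intD : (\int[mu]_(y in D) `|(\1_[set: R] y / (x - y))%:E| < +oo)%E.
  by case/integrableP: hx.
set I := integral _ _ _ in intD.
have I0 : (0 <= I)%E by exact: integral_ge0.
have finI : I \is a fin_num by rewrite ge0_fin_numE.
pose M := fine I; have M0 : 0 <= M by exact: fine_ge0.
pose l := x + 2; pose r := x + 2 * expR (M + 1).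
have e1 : 1 <= expR (M + 1) by rewrite -expR0 ler_expR addr_ge0.
have lr : l <= r by rewrite /l /r lerD2l; lra.
have xl : x < l by rewrite /l; lra.
have [ilr vlr] := integral_cauchy_kernel_oo lr (or_introl xl).
have : (`|(\int[mu]_(y in `]l, r[) (x - y)^-1)%R|%:E <= I)%E.
  rewrite EFin_normr_Rintegral //.
  apply: (le_trans (le_abse_integral _ _ _)) => //.
    exact: (measurable_int mu ilr).
  apply: (@le_trans _ _ (\int[mu]_(y in `]l, r[) `|(\1_[set: R] y / (x - y))%:E|)%E).
    by rewrite le_eqVlt; apply/orP; left; apply/eqP/eq_integral => y _; rewrite indicT mul1r.
  apply: ge0_subset_integral => //.
    by apply: measurableT_comp => //; exact: (measurable_int mu hx).
  move=> y /=; rewrite in_itv /= => /andP[ly _].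
  by rewrite /D /= distrC ltr_normr; apply/orP; left; move: ly; rewrite /l; lra.
rewrite vlr -(fineK finI) lee_fin -/M.
have -> : x - l = - 2 by rewrite /l; ring.
have -> : x - r = - (2 * expR (M + 1)) by rewrite /r; ring.
rewrite !normrN normrM (gtr0_norm (expR_gt0 _)) (ger0_norm (ler0n R 2)) lnM ?posrE ?expR_gt0 //.
have -> (c d : R) : c - (c + d) = - d by ring.
rewrite expRK normrN ger0_norm; lra.
Qed.

Definition nu (a b : R) : R := fine (umeas u `]a, b[).

Lemma umeas_oo_fin_num a b : umeas u `]a, b[ \is a fin_num.
Proof. by apply: (umeas_fin_num wu) => //; exact: subset_itv_oo_cc. Qed.

Lemma umeas_oo a b : umeas u `]a, b[ = (nu a b)%:E.
Proof. by rewrite fineK // umeas_oo_fin_num. Qed.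

Lemma nu_ge0 a b : 0 <= nu a b.
Proof. by rewrite fine_ge0 // umeas_ge0. Qed.

Lemma nu_gt0 a b : a < b -> 0 < nu a b.
Proof. by move=> ab; rewrite -lte_fin -umeas_oo umeas_gt0. Qed.

Lemma umeas_bnd a b (b0 b1 : bool) :
  umeas u [set` Interval (BSide b0 a) (BSide b1 b)] = umeas u `]a, b[.
Proof.
apply: integral_itv_bndoo.
by apply/measurable_EFinP/measurable_funTS; exact: weightR_measurable.
Qed.

Lemma nuD a c b : a <= c -> c <= b -> nu a b = nu a c + nu c b.
Proof.
move=> ac cb; apply: EFin_inj; rewrite EFinD -!umeas_oo.
rewrite -(umeas_bnd a c true false) -(umeas_bnd c b false false) -(umeas_bnd a b true false).
rewrite -umeasU //; last first.
  apply/disj_setPS => x [] /=; rewrite !in_itv /= => /andP[_ h1] /andP[h2 _]; lra.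
congr (umeas u _); apply/seteqP; split => x /=; rewrite !in_itv /=.
  by move=> /andP[h1 h2]; have [h|h] := leP x c; [left; rewrite h1|right].
by case=> /andP[h1 h2]; apply/andP; split; lra.
Qed.

(** If u(R) were finite, the constant 1 would have the finite norm V(u(R)). *)
Lemma nu_unbounded M : exists n : nat, M < nu (- n%:R) n%:R.
Proof.
apply: contrapT => /forallNP nM; apply: lorentz_norm_indicT.
have uT : (umeas u setT <= M%:E)%E.
  apply: (umeas_cvg_le wu (F := fun n => `]- n%:R, n%:R[%classic)) => //.
  - apply/nondecreasing_seqP => n; apply/subsetPset => x /=; rewrite !in_itv /=.
    by rewrite -natr1 => /andP[h1 h2]; apply/andP; split; lra.
  - move=> x _; exists (Num.trunc `|x|).+1 => //=; rewrite in_itv /= -ltr_norml.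
    by rewrite -truncn_lt_nat.
  - by move=> n; rewrite umeas_oo lee_fin leNgt; apply/negP; exact: nM.
have fT : umeas u setT \is a fin_num.
  by rewrite ge0_fin_numE ?umeas_ge0 // (le_lt_trans uT) // ltry.
by rewrite (lorentz_norm_indic ww p0 (T := fine (umeas u setT))) ?fineK // ltry.
Qed.

Lemma nu_surj (a b s : R) : a <= b -> 0 <= s <= nu a b -> exists2 c, a <= c <= b & nu a c = s.
Proof.
move=> ab /andP[s0 sb].
have cts := parameterized_integral_continuous ab (wu.1 a b).
have piE x : parameterized_integral mu a x u = nu a x.
  rewrite /parameterized_integral /Rintegral /nu; congr fine.
  by rewrite -(umeas_bnd a x true false).
have [|c cab <-] := IVT ab cts (v := s); last by exists c; rewrite ?piE.
rewrite !piE; have -> : nu a a = 0 by rewrite /nu set_itvoo0 /umeas integral_set0.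
by rewrite ge_min le_max s0 sb orbT.
Qed.

(** For x in []a, l[], the distance l - x is at most (b - a) - (r - l) <= 2 (r - l), so (r - x) / (l
    - x) >= 3 / 2; the other side is symmetric. *)
Lemma hlog_piece (a b l r x : R) : a <= l -> l < r -> r <= b -> b - a <= 3 * (r - l) ->
  a < x < b -> x < l \/ r < x ->
  ln (3 / 2) <= `|hlog (fun=> l) (fun=> r) 1 x|.
Proof.
move=> al lr rb len /andP[ax xb] xlr; rewrite /hlog big_ord1.
case: xlr => h.
- rewrite distrC (le_trans _ (ler_norm _)) // !ltr0_norm; [|lra|lra].
  rewrite -ln_div ?posrE ?oppr_gt0 ?subr_lt0 //; last lra.
  rewrite ler_ln ?posrE ?divr_gt0 ?oppr_gt0 ?subr_lt0 //; last lra.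
  by rewrite ler_pdivlMr ?oppr_gt0 ?subr_lt0 //; lra.
- rewrite (le_trans _ (ler_norm _)) // !gtr0_norm; [|lra|lra].
  rewrite -ln_div ?posrE ?subr_gt0 //; last lra.
  rewrite ler_ln ?posrE ?divr_gt0 ?subr_gt0 //; last lra.
  by rewrite ler_pdivlMr ?subr_gt0 //; lra.
Qed.

(** Take three adjacent intervals of u-mass s. The longest has at least a third of the total length,
    so its Hilbert transform is bounded below on the other two, whose mass 2s strictly exceeds 3s /
    2. *)
Lemma Vfun_step : exists2 D : R, 0 < D & forall s : R, 0 < s -> V (3 / 2 * s) <= D * V s.
Proof.
have [K K0 hK] := restricted_weak_type wu ww p0 hb.
have ln0 : 0 < ln (3 / 2 : R) by apply: ln_gt0; lra.
exists (K / ln (3 / 2)); first by rewrite divr_gt0.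
move=> s s0.
have [n hn] := nu_unbounded (3 * s).
have nn : - n%:R <= n%:R :> R by rewrite (le_trans _ (ler0n _ _)) // oppr_le0.
have [|x3 /andP[h3 h3'] e3] := nu_surj (s := 3 * s) nn.
  by apply/andP; split; lra.
have [|x2 /andP[h2 h2'] e2] := nu_surj (s := 2 * s) h3.
  by apply/andP; split; lra.
have [|x1 /andP[h1 h1'] e1] := nu_surj (s := s) h2.
  by apply/andP; split; lra.
set a := - n%:R in h1 h2 h3 e1 e2 e3.
have e12 : nu x1 x2 = s by have := nuD h1 h1'; lra.
have e23 : nu x2 x3 = s by have := nuD h2 h2'; lra.
have lt_nu (y z : R) : y <= z -> nu y z = s -> y < z.
  rewrite le_eqVlt => /predU1P[->|//] ns; move: s0.
  by rewrite -ns /nu set_itvoo0 /umeas integral_set0 /= !ltxx.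
have l1 := lt_nu _ _ h1 e1; have l2 := lt_nu _ _ h1' e12; have l3 := lt_nu _ _ h2' e23.
(* Comparing lengths selects one of the three intervals with at least a third of the total. *)
have [l [r [al lr rb nlr len]]] : exists l r, [/\ a <= l, l < r, r <= x3, nu l r = s
    & x3 - a <= 3 * (r - l)].
  have [c1|c1] := leP (x3 - a) (3 * (x1 - a)).
    by exists a, x1; split=> //; lra.
  have [c2|c2] := leP (x3 - a) (3 * (x2 - x1)); [exists x1, x2|exists x2, x3]; split=> //; lra.
have -> : K / ln (3 / 2) * V s = K * V s / ln (3 / 2) by rewrite mulrAC.
rewrite ler_pdivlMr // mulrC -nlr.
apply: (hK (fun=> l) (fun=> r) 1%N l r (`]a, l[ `|` `]r, x3[)).
- by move=> i _; split=> //; exact: ltW.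
- by move=> i j /andP[ij]; rewrite ltnS leqn0 => /eqP j0; move: ij; rewrite j0 ltn0.
- exact: measurableU.
- move=> x [] /=; rewrite in_itv /= => /andP[hx1 hx2]; apply: (hlog_piece al lr rb len).
  + by apply/andP; split; lra.
  + by left.
  + by apply/andP; split; lra.
  + by right.
- by rewrite nlr; lra.
rewrite umeasU //; last first.
  by apply/disj_setPS => x [] /=; rewrite !in_itv /= => /andP[_ g1] /andP[g2 _]; lra.
rewrite !umeas_oo -EFinD lte_fin.
have := nuD al (ltW lr); have := nuD (le_trans al (ltW lr)) rb; lra.
Qed.

(** If V(s) = 0, iterating [Vfun_step] gives V = 0 everywhere, hence W = 0, and the constant 1 would
    have norm 0. *)
Lemma Vfun_gt0 (s : R) : 0 < s -> 0 < V s.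
Proof.
move=> s0; rewrite lt_def; apply/andP; split; last exact: Vfun_ge0.
apply/eqP => Vs0; apply: lorentz_norm_indicT.
have [D D0 hD] := Vfun_step.
have Vn n : V ((3 / 2) ^+ n * s) = 0.
  elim: n => [|n IH]; first by rewrite expr0 mul1r.
  apply/le_anti/andP; split; last exact: Vfun_ge0.
  rewrite exprS -mulrA (le_trans (hD _ _)) ?IH ?mulr0 //.
  by rewrite mulr_gt0 // exprn_gt0; lra.
have Vt t : V t = 0.
  apply/le_anti/andP; split; last exact: Vfun_ge0.
  have [n tn] : exists n, t <= (3 / 2) ^+ n * s.
    have bern n : n%:R / 2 <= (3 / 2 : R) ^+ n.
      elim: n => [|n IH]; first by rewrite mul0r expr0 ler01.
      have : 1 <= (3 / 2 : R) ^+ n by apply: exprn_ege1; lra.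
      by rewrite exprS -(natr1 n); lra.
    pose n := (Num.trunc `|2 * t / s|).+1; exists n.
    have : `|2 * t / s| < n%:R by rewrite -truncn_lt_nat.
    move=> /(le_lt_trans (ler_norm _)); rewrite ltr_pdivrMr // => tn.
    apply: (@le_trans _ _ (n%:R / 2 * s)); first by lra.
    by rewrite ler_pM2r.
  by rewrite -(Vn n); exact: le_Vfun.
have Wt t : Wfun w t = 0.
  have := Vt t; rewrite /Vfun => /eqP; rewrite powR_eq0 => /andP[/eqP h _].
  by rewrite -(fineK (Wfun_fin_num ww t)) h.
have uT : umeas u setT = +oo%E.
  apply/eqyP => M _.
  have [n hn] := nu_unbounded M.
  apply: (@le_trans _ _ (umeas u `]- n%:R, n%:R[)); last exact: le_umeas.
  by rewrite umeas_oo lee_fin ltW.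
rewrite /lorentz_norm.
rewrite (_ : integral _ _ _ = 0) ?poweR0r ?invr_neq0 ?gt_eqF // ?ltry //.
transitivity (\int[mu]_(t in `]0%R, +oo[) (w t)%:E)%E.
  apply: eq_integral => t /set_mem /=; rewrite in_itv /= andbT => t0.
  by rewrite rearr_indic // uT ltry poweR1r mul1e.
(* The integral of w over the half-line is the limit of W(n), which vanishes. *)
pose F : (set R)^nat := fun n => `]0, n%:R[%classic.
have -> : `]0, +oo[%classic = \bigcup_n F n.
  apply/seteqP; split => x /=.
    rewrite in_itv /= andbT => x0; exists (Num.trunc `|x|).+1 => //=.
    by rewrite /F /= in_itv /= x0 (le_lt_trans (ler_norm _)) // -truncn_lt_nat.
  by move=> [n _] /=; rewrite /F /= !in_itv /= => /andP[->].
have h : (\int[mu]_(x in F n) (w x)%:E)%E @[n --> \oo] -->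
    (\int[mu]_(x in \bigcup_n F n) (w x)%:E)%E.
  apply: ge0_nondecreasing_set_cvg_integral => //.
  - apply/nondecreasing_seqP => n; apply/subsetPset => x; rewrite /F /= !in_itv /=.
    by rewrite -natr1 => /andP[-> h2]; rewrite /=; lra.
  - by move=> n; exact: measurable_itv.
  - case=> [|n]; first by rewrite /F set_itvoo0; exact: measurable_fun_set0.
    exact: (measurable_int mu (ww.2 _ _)).
  - by move=> n x; rewrite /F /= in_itv /= lee_fin => /andP[/ww.1].
rewrite -(cvg_lim _ h) //; apply/cvg_lim => //.
by under eq_fun do rewrite -/(Wfun w _) Wt; exact: cvg_cst.
Qed.

(** Four steps suffice, as (3/2)^4 = 81/16 >= 4. The factor 4 matches the quarter of the mass in
    [mass_quarter]. *)
Lemma Vfun_doubling : exists2 D : R, 0 < D & forall s : R, 0 < s -> V (4 * s) <= D * V s.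
Proof.
have [D D0 hD] := Vfun_step; exists (D ^+ 4); first exact: exprn_gt0.
move=> s s0; apply: (@le_trans _ _ (V ((3 / 2) ^+ 4 * s))).
  by apply: le_Vfun => //; lra.
have step k : V ((3 / 2) ^+ k * s) <= D ^+ k * V s.
  elim: k => [|k IH]; first by rewrite !expr0 !mul1r.
  rewrite exprS -mulrA; apply: (le_trans (hD _ _)).
    by rewrite mulr_gt0 // exprn_gt0; lra.
  by rewrite exprS -mulrA ler_pM2l.
exact: step.
Qed.

End Doubling.

(** * Dyadic trees *)

(** A finite union of dyadic cells, [Leaf true] marking a filled one. The tree carries no interval,
    so the same pattern can be placed on any interval, in particular on either half of a given
    one. *)
Inductive dtree := Leaf of bool | Node of dtree & dtree.

Section Trees.
Variable R : realType.
Implicit Types (t : dtree) (a b : R).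

Definition mid a b : R := (a + b) / 2.

Lemma mid_lt a b : a < b -> a < mid a b < b.
Proof. by move=> ab; rewrite /mid; apply/andP; split; lra. Qed.

Fixpoint frac t : R :=
  match t with
  | Leaf c => if c then 1 else 0
  | Node l r => (frac l + frac r) / 2
  end.

Fixpoint cells t a b : seq (R * R) :=
  match t with
  | Leaf c => if c then [:: (a, b)] else [::]
  | Node l r => cells l a (mid a b) ++ cells r (mid a b) b
  end.

Definition mass (g : R -> R -> R) t a b : R :=
  \sum_(c <- cells t a b) g c.1 c.2.

Lemma mass_Node g l r a b :
  mass g (Node l r) a b = mass g l a (mid a b) + mass g r (mid a b) b.
Proof. by rewrite /mass big_cat. Qed.

Lemma mass_Leaf g c a b : mass g (Leaf c) a b = if c then g a b else 0.
Proof. by rewrite /mass; case: c; rewrite /= ?big_seq1 ?big_nil. Qed.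

Lemma frac_ge0 t : 0 <= frac t.
Proof. by elim: t => [[]|l hl r hr] //=; rewrite divr_ge0 // addr_ge0. Qed.

Lemma cells_bounds t a b c : a < b -> c \in cells t a b ->
  [/\ a <= c.1, c.1 < c.2 & c.2 <= b].
Proof.
elim: t a b => [[]|l hl r hr] a b ab //=; first by rewrite inE => /eqP ->.
have /andP[am mb] := mid_lt ab.
rewrite mem_cat => /orP[/hl|/hr] [] // h1 h2 h3; split=> //.
  exact: le_trans h3 (ltW mb).
exact: le_trans (ltW am) h1.
Qed.

Lemma cells_sorted t a b : a < b ->
  pairwise (fun c d : R * R => c.2 <= d.1) (cells t a b).
Proof.
elim: t a b => [[]|l hl r hr] a b ab //=.
have /andP[am mb] := mid_lt ab.
rewrite pairwise_cat hl // hr // !andbT; apply/allrelP => c d.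
move=> /(cells_bounds am)[_ _ h1] /(cells_bounds mb)[h2 _ _].
exact: le_trans h1 h2.
Qed.

Lemma mass_length t a b : mass (fun x y => y - x) t a b = frac t * (b - a).
Proof.
elim: t a b => [[]|l hl r hr] a b; rewrite ?mass_Leaf ?mass_Node /=.
- by rewrite mul1r.
- by rewrite mul0r.
- by rewrite hl hr /mid; field.
Qed.

Section Decay.
Variables (g : R -> R -> R) (alpha : R).
Hypothesis alpha_itv : 0 < alpha < 1.
Hypothesis small_frac :
  forall t a b, a < b -> frac t <= alpha -> mass g t a b <= g a b / 2.

(* Calderon-Zygmund stopping: t' fills the first cells one half of which has
   t-density above alpha; there t has density in ]alpha / 2, alpha]. *)
Lemma dyadic_enlarge t a b : a < b -> frac t <= alpha ->
  exists t', mass g t a b <= mass g t' a b / 2 /\ frac t' <= 2 / alpha * frac t.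
Proof.
have /andP[a0 a1] := alpha_itv.
elim: t a b => [[]|l hl r hr] a b ab ta.
- by move: ta; rewrite /= leNgt a1.
- by exists (Leaf false); rewrite !mass_Leaf mul0r /= mulr0.
have /andP[am mb] := mid_lt ab.
have [la|la] := leP (frac l) alpha; have [ra|ra] := leP (frac r) alpha.
- have [l' [h1 h2]] := hl _ _ am la; have [r' [h3 h4]] := hr _ _ mb ra.
  exists (Node l' r'); rewrite !mass_Node; split; first by lra.
  by rewrite /= mulrA mulrDr ler_pM2r ?lerD // invr_gt0.
all: exists (Leaf true); rewrite mass_Leaf; split; first exact: small_frac.
all: rewrite /= mulrAC ler_pdivlMr // mul1r.
all: have := frac_ge0 l; have := frac_ge0 r; lra.
Qed.

(** Each enlargement multiplies the density by at most 2 / alpha while the original mass is at most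
    half the new one. After k enlargements the density is still at most alpha, and [small_frac]
    gives the last factor 1/2. *)
Lemma mass_decay k t a b : a < b -> frac t <= alpha * (alpha / 2) ^+ k ->
  mass g t a b <= 2^-1 ^+ k.+1 * g a b.
Proof.
have /andP[a0 a1] := alpha_itv.
elim: k t => [|k IH] t ab.
  by rewrite expr0 mulr1 expr1 mulrC => /small_frac; exact.
move=> ta.
have ta' : frac t <= alpha.
  apply: (le_trans ta); apply: ler_piMr; first exact: ltW.
  by apply: exprn_ile1; lra.
have [t' [h1 h2]] := dyadic_enlarge ab ta'.
have /IH : frac t' <= alpha * (alpha / 2) ^+ k.
  apply: (le_trans h2); rewrite mulrC -ler_pdivlMr ?divr_gt0 //.
  rewrite (le_trans ta) // exprSr invf_div; lra.
by move=> /(_ ab) h3; apply: (le_trans h1); rewrite exprS; lra.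
Qed.

End Decay.

(** Half-open cells make the two halves partition their parent exactly; the open intervals of
    [cells] are the ones fed to the Hilbert transform. *)
Fixpoint hset t a b : set R :=
  match t with
  | Leaf c => if c then `]a, b]%classic else set0
  | Node l r => hset l a (mid a b) `|` hset r (mid a b) b
  end.

Lemma hset_sub t a b : a < b -> hset t a b `<=` `]a, b].
Proof.
elim: t a b => [[]|l hl r hr] a b ab //=.
have /andP[am mb] := mid_lt ab.
move=> x [/(hl _ _ am)|/(hr _ _ mb)] /=; rewrite !in_itv /= => /andP[h1 h2];
  by apply/andP; split; lra.
Qed.

Lemma hset_disj l r a b : a < b ->
  [disjoint hset l a (mid a b) & hset r (mid a b) b].
Proof.
move=> ab; have /andP[am mb] := mid_lt ab.
apply/disj_setPS => x [/(hset_sub am) xa /(hset_sub mb) xb].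
move: xa xb; rewrite /= !in_itv /= => /andP[_ h1] /andP[h2 _].
by move: h1; rewrite leNgt h2.
Qed.

Lemma measurable_hset t a b : measurable (hset t a b).
Proof.
elim: t a b => [[]|l hl r hr] a b //=; exact: measurableU.
Qed.

Lemma lebesgue_hset t a b : a < b ->
  lebesgue_measure (hset t a b) = (frac t * (b - a))%:E.
Proof.
elim: t a b => [[]|l hl r hr] a b ab /=.
- by rewrite lebesgue_measure_itv /= lte_fin ab mul1r.
- by rewrite measure0 mul0r.
have /andP[am mb] := mid_lt ab.
transitivity (lebesgue_measure (hset l a (mid a b)) +
    lebesgue_measure (hset r (mid a b) b))%E.
  apply: measureU; [exact: measurable_hset|exact: measurable_hset|].
  by apply/eqP; exact: hset_disj.
by rewrite hl // hr // -EFinD; congr EFin; rewrite /mid; field.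
Qed.

(** The maximal dyadic cells of generation at most n contained in U. *)
Fixpoint inner (U : set R) n a b : dtree :=
  if `[< `]a, b] `<=` U >] then Leaf true
  else if n is n'.+1 then Node (inner U n' a (mid a b)) (inner U n' (mid a b) b)
  else Leaf false.

Lemma inner_sub U n a b : hset (inner U n a b) a b `<=` U.
Proof.
elim: n a b => [|n IH] a b /=; case: asboolP => // _ x; first by case.
by case=> /IH.
Qed.

Lemma inner_homo U n a b : a < b ->
  hset (inner U n a b) a b `<=` hset (inner U n.+1 a b) a b.
Proof.
elim: n a b => [|n IH] a b ab; first by rewrite /=; case: asboolP => // _ x [].
have /andP[am mb] := mid_lt ab.
rewrite [inner U n.+1 a b]/= [inner U n.+2 a b]/=; case: asboolP => _.
  exact: subset_refl.
by move=> x [hx|hx]; [left; exact: (IH _ _ am)|right; exact: (IH _ _ mb)].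
Qed.

(** A cell of generation n is shorter than d, so the one containing x lies in U. *)
Lemma inner_cover U n (x d a b : R) : `]x - d, x + d[ `<=` U ->
  a < x <= b -> b - a < 2 ^+ n * d -> hset (inner U n a b) a b x.
Proof.
move=> xU; elim: n a b => [|n IH] a b /andP[ax xb] len /=.
  case: asboolP => [_|] /=; first by rewrite in_itv /= ax.
  case; apply: subset_trans xU => y /=; rewrite !in_itv /= => /andP[h1 h2].
  by move: len; rewrite expr0 mul1r => len; apply/andP; split; lra.
case: asboolP => [_|_] /=; first by rewrite in_itv /= ax.
rewrite exprS in len; set e := 2 ^+ n in len IH.
have [xm|xm] := leP x (mid a b); [left|right]; apply: IH; rewrite ?ax ?xm //.
  by rewrite /mid; lra.
by rewrite /mid; lra.
Qed.

End Trees.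

(** * From dyadic to measurable sets *)

Section Ainfty.
Variables (R : realType) (u w : R -> R) (p : R).
Local Notation mu := (@lebesgue_measure R).
Hypotheses (wu : weightR u) (ww : weight0 w) (p0 : 0 < p).
Hypothesis hb : hilbert_bounded u w p.
Local Notation V := (Vfun w p).
Local Notation nu := (nu u).

Lemma umeas_bigcup_itv (l r : nat -> R) n :
  (forall i j, (i < j < n)%N -> r i <= l j) ->
  umeas u (\bigcup_(i < n) `]l i, r i[%classic) = (\sum_(i < n) nu (l i) (r i))%:E.
Proof.
rewrite bigcup_mkord; elim: n => [|n IH] rl.
  by rewrite !big_ord0 umeas_set0.
rewrite !big_ord_recr /= umeasU //.
- rewrite IH; first by rewrite umeas_oo.
  by move=> i j /andP[ij jn]; apply: rl; rewrite ij ltnW.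
- by apply: bigsetU_measurable => i _; exact: measurable_itv.
rewrite -(bigcup_mkord n (fun i => `]l i, r i[%classic)); apply/disj_setPS => x [[i /= ni]].
rewrite /= !in_itv /= => /andP[_ h1] /andP[h2 _].
have := rl i n; rewrite ni ltnSn => /(_ isT).
by rewrite leNgt (lt_trans h2 h1).
Qed.

Lemma mass_nth (g : R -> R -> R) t a b :
  mass g t a b = \sum_(i < size (cells t a b))
    g (nth (0, 0) (cells t a b) i).1 (nth (0, 0) (cells t a b) i).2.
Proof. by rewrite /mass (big_nth (0, 0)) big_mkord. Qed.

(** The tree is placed on one half of []a, b[], leaving the other half as room for the roots. If its
    mass exceeded T / 4 with T = u([]a, b[]), testing would give lam V(T/4) <= K V(T) <= K D V(T/4),
    contradicting lam > K D. *)
Lemma mass_quarter : exists2 tau : R, 0 < tau & forall t a b, a < b ->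
  frac R t <= tau ->
  mass nu t a (mid a b) <= nu a b / 4 /\ mass nu t (mid a b) b <= nu a b / 4.
Proof.
have [K K0 hK] := restricted_weak_type wu ww p0 hb.
have [D D0 hD] := Vfun_doubling wu ww p0 hb.
pose lam := K * D + 1.
have lam0 : 0 < lam by rewrite ltr_wpDl // ltW // mulr_gt0.
have elam : 1 < expR lam by rewrite expR_gt1.
(* This c solves c / (c - 1) = e^lam, so the lower bound of the level-set lemmas is exactly lam. *)
pose c := expR lam / (expR lam - 1).
have c1 : 1 < c by rewrite /c ltr_pdivlMr ?mul1r; lra.
have lnc : ln (c / (c - 1)) = lam.
  rewrite -[RHS]expRK; congr ln; rewrite /c.
  by field; apply/andP; split; apply/eqP; lra.
have contra (T : R) : 0 < T -> lam * V (T / 4) <= K * V T -> False.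
  move=> T0; apply/negP; rewrite -ltNge.
  have T4 : 0 < T / 4 by rewrite divr_gt0.
  have := hD _ T4; rewrite mulrCA divff // mulr1 => h.
  have V0 := Vfun_gt0 wu ww p0 hb T4.
  apply: (@le_lt_trans _ _ (K * (D * V (T / 4)))); first by rewrite ler_pM2l.
  by rewrite mulrA /lam mulrDl mul1r ltrDl.
(* The cells have total length [frac t] times half of b - a, and [x0] is at that same half-length
   from m; the quotient in the level-set lemmas is therefore [frac t], which must be at most ln
   c. *)
exists (ln c); first exact: ln_gt0.
move=> t a b ab tc; have /andP[am mb] := mid_lt ab.
have midl : mid a b - a = (b - a) / 2 by rewrite /mid; field.
have midr : b - mid a b = (b - a) / 2 by rewrite /mid; field.
have ba0 : (b - a) / 2 != 0 by apply/eqP; lra.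
have ec : expR (frac R t) <= c by rewrite -[leRHS]lnK ?ler_expR // posrE (lt_trans _ c1).
have T0 := nu_gt0 wu ab.
split; rewrite leNgt; apply/negP => hm; apply: (contra _ T0).
- set s := cells t a (mid a b); set n := size s.
  pose x i := (nth (0, 0) s i).1; pose y i := (nth (0, 0) s i).2.
  have xy i : (i < n)%N -> [/\ a <= x i, x i < y i & y i <= mid a b].
    by move=> ni; apply: (cells_bounds am); exact: mem_nth.
  have yx i j : (i < j < n)%N -> y i <= x j.
    move=> /andP[ij jn]; have /(pairwiseP (0, 0)) := cells_sorted t am.
    by move=> h; apply: h => //; rewrite inE //; exact: ltn_trans ij jn.
  have [||||r [r1 r2 r3]] := @level_set_right R x y n c (mid a b) b c1 mb.
  + by move=> i /xy[].
  + exact: yx.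
  + by move=> i /xy[].
  + by rewrite -(mass_nth (fun v z => z - v)) mass_length midl midr mulfK.
  apply: (hK y r n a b (\bigcup_(i < n) `]x i, y i[%classic)).
  + move=> i ni; have [h1 h2 h3] := xy _ ni; have /andP[h4 h5] := r1 _ ni.
    by split=> //; exact: le_trans h1 (ltW h2).
  + exact: r2.
  + by apply: bigcup_measurable => i _; exact: measurable_itv.
  + move=> z [i /= ni]; rewrite in_itv /= => zi; rewrite -lnc; exact: r3 ni zi.
  + by rewrite divr_gt0.
  + by rewrite umeas_bigcup_itv // lte_fin -mass_nth.
(* For the right half the intervals ending at the cells extend to the left, with [a] in the role of
   [x0]. *)
- set s := cells t (mid a b) b; set n := size s.
  pose x i := (nth (0, 0) s i).1; pose y i := (nth (0, 0) s i).2.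
  have xy i : (i < n)%N -> [/\ mid a b <= x i, x i < y i & y i <= b].
    by move=> ni; apply: (cells_bounds mb); exact: mem_nth.
  have yx i j : (i < j < n)%N -> y i <= x j.
    move=> /andP[ij jn]; have /(pairwiseP (0, 0)) := cells_sorted t mb.
    by move=> h; apply: h => //; rewrite inE //; exact: ltn_trans ij jn.
  have [||||l [l1 l2 l3]] := @level_set_left R x y n c (mid a b) a c1 am.
  + by move=> i /xy[].
  + exact: yx.
  + by move=> i /xy[].
  + by rewrite -(mass_nth (fun v z => z - v)) mass_length midl midr mulfK.
  apply: (hK l x n a b (\bigcup_(i < n) `]x i, y i[%classic)).
  + move=> i ni; have [h1 h2 h3] := xy _ ni; have /andP[h4 h5] := l1 _ ni.
    by split=> //; exact: le_trans (ltW h2) h3.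
  + exact: l2.
  + by apply: bigcup_measurable => i _; exact: measurable_itv.
  + move=> z [i /= ni]; rewrite in_itv /= => zi; rewrite -lnc; exact: l3 ni zi.
  + by rewrite divr_gt0.
  + by rewrite umeas_bigcup_itv // lte_fin -mass_nth.
Qed.

Lemma mass_half : exists2 alpha : R, 0 < alpha <= 1 / 2 & forall t a b, a < b ->
  frac R t <= alpha -> mass nu t a b <= nu a b / 2.
Proof.
have [tau tau0 htau] := mass_quarter.
(* A subtree has at most twice the density of the tree, hence tau / 2; the bound 1 / 2 excludes the
   full leaf. *)
exists (Num.min (tau / 2) (1 / 2)).
  by rewrite lt_min ge_min lexx orbT divr_gt0 //= divr_gt0.
move=> t a b ab; rewrite le_min => /andP[t1 t2].
have := nu_gt0 wu ab.
case: t t1 t2 => [[]|l r] /= t1 t2 nu0; rewrite ?mass_Leaf ?mass_Node; [lra|lra|].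
have [|hl _] := htau l a b ab; first by have := frac_ge0 R r; lra.
have [|_ hr] := htau r a b ab; first by have := frac_ge0 R l; lra.
lra.
Qed.

Lemma umeas_hset t a b : a < b -> umeas u (hset t a b) = (mass nu t a b)%:E.
Proof.
elim: t a b => [[]|l hl r hr] a b ab; rewrite ?mass_Leaf ?mass_Node /=.
- by rewrite umeas_bnd // umeas_oo.
- by rewrite umeas_set0.
have /andP[am mb] := mid_lt ab.
rewrite umeasU ?hl ?hr //; try exact: measurable_hset.
exact: hset_disj.
Qed.

(** The strict inequality leaves room for an open U containing E and still below the threshold.
    Dyadic trees inside U inherit the bound on density, so [mass_decay] applies to each and passes
    to their increasing union. *)
Lemma umeas_decay : exists2 alpha : R, 0 < alpha <= 1 / 2 &
  forall k a b (E : set R), a < b -> measurable E -> E `<=` `[a, b] ->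
    (mu E < (alpha * (alpha / 2) ^+ k * (b - a))%:E)%E ->
    (umeas u E <= (2^-1 ^+ k.+1 * nu a b)%:E)%E.
Proof.
have [alpha aI half] := mass_half; exists alpha => // k a b E ab mE Eab muE.
have aI' : 0 < alpha < 1 by case/andP: aI => h1 h2; apply/andP; split; lra.
have muEfin : mu E \is a fin_num by rewrite ge0_fin_numE // (lt_trans muE) // ltry.
set L := alpha * _ * _ in muE.
have [||U [oU EU UE]] := lebesgue_regularity_outer (eps := L - fine (mu E)) mE.
- by rewrite (lt_trans muE) // ltry.
- by rewrite subr_gt0 -lte_fin fineK.
have mU : measurable U by exact: open_measurable.
have muU : (mu U <= L%:E)%E.
  rewrite -(setDUK EU) measureU ?setDIK //; last exact: measurableD.
  by rewrite -[in leRHS](subrKC (fine (mu E)) L) EFinD fineK // leeD2l // ltW.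
pose F n := hset (inner U n a b) a b.
have mE' : measurable (E `&` `]a, b]) by exact: measurableI.
(* The half-open cells never contain the left endpoint [a], a null set that is removed first. *)
have uE : (umeas u E <= umeas u (E `&` `]a, b]))%E.
  apply: (@le_trans _ _ (umeas u ((E `&` `]a, b]) `|` [set a]))).
    apply: le_umeas => //; first exact: measurableU.
    move=> x Ex; have := Eab _ Ex; rewrite /= in_itv /= => /andP[ax xb].
    move: ax; rewrite le_eqVlt => /predU1P[->|ax]; [by right|left; split=> //].
    by rewrite /= in_itv /= ax.
  rewrite umeasU //; last first.
    by apply/disj_setPS => x [[_ +] xa]; rewrite xa /= in_itv /= ltxx.
  by rewrite [X in (_ + X)%E]umeas_null ?adde0 // lebesgue_measure_set1.
apply: (le_trans uE); apply: (umeas_cvg_le wu (F := F)) => //.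
- by apply/nondecreasing_seqP => n; apply/subsetPset; exact: inner_homo.
- by move=> n; exact: measurable_hset.
- move=> x [Ex]; rewrite /= in_itv /= => xab.
  have [d d0 dU] : exists2 d, 0 < d & `]x - d, x + d[ `<=` U.
    have := open_itvoo_subset oU (EU _ Ex); move=> [e /= e0 he].
    exists (e / 2); first by rewrite divr_gt0.
    apply: he; last by rewrite divr_gt0.
    by rewrite /= sub0r normrN gtr0_norm ?divr_gt0 //; lra.
  (* This depth works because 2^n > n > (b - a) / d. *)
  pose n := (Num.trunc `|(b - a) / d|).+1; exists n => //.
  apply: (inner_cover dU xab).
  rewrite -ltr_pdivrMr //; apply: (le_lt_trans (ler_norm _)).
  have : `|(b - a) / d| < n%:R by rewrite -truncn_lt_nat.
  move=> /lt_le_trans; apply; rewrite -natrX ler_nat ltnW //; exact: ltn_expl.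
- move=> n; rewrite umeas_hset // lee_fin; apply: (mass_decay aI' half) => //.
  rewrite -(ler_pM2r (x := b - a)) ?subr_gt0 // -lee_fin -lebesgue_hset //.
  apply: le_trans muU; apply: le_measure; rewrite ?inE //; first exact: measurable_hset.
  exact: inner_sub.
Qed.

Lemma umeas_between a b (I : set R) : `]a, b[ `<=` I -> I `<=` `[a, b] ->
  measurable I /\ umeas u I = (nu a b)%:E.
Proof.
move=> sI Is.
have fin : finite_set (I `&` [set a; b]) by apply: finite_setIr; exact: finite_set2.
have IE : I = `]a, b[ `|` (I `&` [set a; b]).
  apply/seteqP; split => [x Ix|x [/sI//|[]//]].
  have := Is _ Ix; rewrite /= !in_itv /= => /andP[].
  rewrite le_eqVlt => /predU1P[->|ax]; first by right; split; [|left].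
  rewrite le_eqVlt => /predU1P[<-|xb]; first by right; split; [|right].
  by left; rewrite ax.
have mI : measurable I by rewrite IE; apply: measurableU => //; exact: finite_measurable.
split=> //; rewrite -umeas_oo //; apply/le_anti/andP; split; last exact: le_umeas.
by rewrite -(umeas_bnd wu a b true false); apply: le_umeas.
Qed.

(** With q = alpha / 2 and q^delta = 1/2, geometric decay becomes a power law: if s = |E| / |I| lies
    between alpha q^(k+1) and alpha q^k, then u(E) / u(I) <= 2^-(k+1) = (q^(k+1))^delta <= (s /
    alpha)^delta. *)
Lemma Ainfty_of_decay (alpha : R) : 0 < alpha <= 1 / 2 ->
  (forall k a b (E : set R), a < b -> measurable E -> E `<=` `[a, b] ->
    (mu E < (alpha * (alpha / 2) ^+ k * (b - a))%:E)%E ->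
    (umeas u E <= (2^-1 ^+ k.+1 * nu a b)%:E)%E) ->
  A_infty u.
Proof.
move=> /andP[a0 a1] dec; pose q := alpha / 2.
have q0 : 0 < q by rewrite divr_gt0.
have alpha1 : alpha <= 1 by lra.
have q2 : q <= 2^-1 by rewrite /q; lra.
have lnq : ln q < - ln 2.
  by rewrite -lnV ?posrE // ltr_ln ?posrE ?invr_gt0 // /q; lra.
have ln2 : 0 < ln (2 : R) by apply: ln_gt0; lra.
(* This solves q^delta = 1/2; it is below 1 because q < 1/2. *)
pose delta := ln 2 / - ln q.
have d1 : 0 < delta < 1.
  by rewrite divr_gt0 ?ltr_pdivrMr ?mul1r //=; lra.
have qd : q `^ delta = 2^-1.
  have -> : q `^ delta = expR (- ln 2).
    rewrite /powR gt_eqF //; congr expR; rewrite /delta; field.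
    by apply/eqP; lra.
  by rewrite expRN lnK // posrE.
exists (alpha `^ delta)^-1, delta; split; first by rewrite invr_gt0 powR_gt0.
split=> // a b I E ab sI Is mE EI.
have [mI uI] := umeas_between sI Is.
have nu0 := nu_gt0 wu ab.
have Eab : E `<=` `[a, b] by exact: subset_trans EI Is.
have finE := umeas_fin_num wu mE Eab.
have muE : (mu E <= (b - a)%:E)%E.
  apply: (@le_trans _ _ (mu `[a, b])); first by apply: le_measure; rewrite ?inE.
  by rewrite lebesgue_measure_itv /= lte_fin ab.
have finmu : mu E \is a fin_num by rewrite ge0_fin_numE // (le_lt_trans muE) // ltry.
rewrite uI /= ler_pdivrMr //.
set s := fine (mu E) / (b - a).
have muEs : mu E = (s * (b - a))%:E by rewrite /s mulfVK ?fineK // gt_eqF // subr_gt0.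
have s0 : 0 <= s by rewrite divr_ge0 ?fine_ge0 // subr_ge0 ltW.
have uEI : fine (umeas u E) <= nu a b.
  by rewrite -lee_fin fineK // -uI; exact: le_umeas.
have [ss0|sn0] := eqVneq s 0.
  rewrite umeas_null //; last by rewrite muEs ss0 mul0r.
  by rewrite /= mulr_ge0 ?nu_ge0 // mulr_ge0 ?powR_ge0 // invr_ge0 powR_ge0.
have {sn0} s0' : 0 < s by rewrite lt_def sn0.
have ad0 : 0 < alpha `^ delta by rewrite powR_gt0.
(* For s >= alpha the right-hand factor is at least 1 and u(E) <= u(I) suffices. *)
have [sa|sa] := leP alpha s.
  apply: (le_trans uEI); rewrite ler_peMl ?nu_ge0 //.
  rewrite ler_pdivlMl // mulr1; apply: ge0_ler_powR => //; first by case/andP: d1 => /ltW.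
  by rewrite nnegrE ltW.
have exk : exists k, alpha * q ^+ k.+1 <= s.
  have [k sk] : exists k, s^-1 <= 2 ^+ k.+1.
    exists (Num.trunc s^-1).
    have : s^-1 < (Num.trunc s^-1).+1%:R by rewrite -truncn_lt_nat // invr_ge0 ltW.
    move=> /ltW/le_trans; apply; rewrite -natrX ler_nat ltnW //; exact: ltn_expl.
  exists k.
  apply: (@le_trans _ _ (2^-1 ^+ k.+1)).
    rewrite -[leRHS]mul1r; apply: ler_pM.
    - exact: ltW.
    - by apply: exprn_ge0; exact: ltW.
    - exact: alpha1.
    - by apply: lerXn2r; rewrite ?nnegrE ?invr_ge0 //; exact: ltW.
  by rewrite exprVn invf_ple ?posrE ?exprn_gt0.
(* Minimality of k gives s < alpha q^k; for k = 0 this is the assumption s < alpha. *)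
have kP := ex_minnP exk; case: kP => k ks kmin.
have sk : s < alpha * q ^+ k.
  case: k {ks} kmin => [|k] kmin; first by rewrite expr0 mulr1.
  by rewrite ltNge; apply/negP => /kmin; rewrite ltnn.
have uEk := dec k a b E ab mE Eab.
rewrite muEs lte_fin ltr_pM2r ?subr_gt0 // in uEk.
have {uEk} := uEk sk; rewrite -(fineK finE) lee_fin => uEk.
apply: (le_trans uEk); rewrite ler_pM2r // ler_pdivlMl //.
apply: (@le_trans _ _ ((alpha * q ^+ k.+1) `^ delta)); last first.
  apply: ge0_ler_powR => //; first by case/andP: d1 => /ltW.
  by rewrite nnegrE ltW // mulr_gt0 // exprn_gt0.
rewrite (powRM _ (ltW a0) (exprn_ge0 _ (ltW q0))) ler_pM2l //.
by rewrite -(powR_mulrn _ (ltW q0)) powRAC qd powR_mulrn // invr_ge0.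
Qed.

End Ainfty.

Theorem theorem3p5 (R : realType) (u w : R -> R) (p : R) :
  weightR u -> weight0 w -> 0 < p ->
  hilbert_bounded u w p ->
  A_infty u.
Proof.
move=> wu ww p0 hb; have [alpha aI dec] := umeas_decay wu ww p0 hb.
exact: (@Ainfty_of_decay _ _ wu _ aI dec).
Qed.
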